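(* Let $\Lambda$ be a finite set and let $H_\Lambda(\omega) = T + V(\omega)$ act on $\ell^2(\Lambda)$, where $T$ is a fixed Hermitian operator on $\ell^2(\Lambda)$ and $V(\omega) = \mathrm{diag}(V_x(\omega))_{x\in\Lambda}$ is a random diagonal matrix whose joint distribution $\mathbb{P}$ on $\mathbb{R}^{|\Lambda|}$ satisfies the following regularity assumption: for each $x \in \Lambda$, the conditional distribution of $V_x$ given $\{V_y\}_{y \neq x}$ is absolutely continuous with respect to Lebesgue measure with density bounded uniformly by a constant $\rho_\infty$. Let $n \ge 1$, $\alpha > 0$, let $I_1,\dots,I_n \subseteq \mathbb{R}$ be Borel sets and $B_1,\dots,B_n \subseteq \Lambda$. Let $\mathcal{E}_\alpha(I_1,\dots,I_n;B_1,\dots,B_n)$ denote the event that $H_\Lambda(\omega)$ has eigenvalues $E_1\in I_1,\dots,E_n\in I_n$ whose normalized eigenfunctions $\psi_1,\dots,\psi_n$ have $\alpha$-distinct profiles within the sets $B_1,\dots,B_n$, i.e. $$\sum_{x_1\in B_1}\cdots\sum_{x_n\in B_n}\left|\det\left(|\psi_j(x_k)|^2\right)_{j,k=1}^n\right| \ge \alpha^n.$$ Then $$\mathbb{P}\big(\mathcal{E}_\alpha(I_1,\dots,I_n;B_1,\dots,B_n)\big) \le \frac{n!}{\alpha^n}\,\rho_\infty^n\prod_{j=1}^n |I_j|\,|B_j|,$$ where $|I_j|$ is the Lebesgue measure of $I_j$ and $|B_j|$ the cardinality of $B_j$.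
   Context: Normalized functions $\psi_1,\dots,\psi_n\in\ell^2(\Lambda)$ (with $\|\psi_j\|=1$) are said to have $\alpha$-distinct profiles within sets $B_1,\dots,B_n\subseteq\Lambda$ if the displayed sum of absolute values of determinants is at least $\alpha^n$. The probability space is identified with $\mathbb{R}^{|\Lambda|}$ with the $V_x$ as coordinates. *)

(* Defs.v *)
From HB Require Import structures.
From mathcomp Require Import all_boot all_order all_algebra.
From mathcomp Require Import all_classical all_reals all_analysis.
From mathcomp Require Import complex.
Set Implicit Arguments. Unset Strict Implicit. Unset Printing Implicit Defensive.
Import Order.TTheory GRing.Theory Num.Theory.
Local Open Scope classical_set_scope.
Local Open Scope ring_scope.
Local Open Scope complex_scope.

Section Defs.
Variables (R : realType) (L : finType).

Definition sqmod (z : complex R) : R := complex.Re z ^+ 2 + complex.Im z ^+ 2.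

Definition hermitian_kernel (T : L -> L -> complex R) : Prop :=
  forall x y, T y x = (T x y)^*.

Definition applyH (T : L -> L -> complex R) (v : L -> R) (psi : L -> complex R) (x : L) : complex R :=
  \sum_(y : L) T x y * psi y + (v x)%:C * psi x.

Definition normalized_eigenfunction (T : L -> L -> complex R) (v : L -> R) (E : R)
    (psi : L -> complex R) : Prop :=
  \sum_(x : L) sqmod (psi x) = 1 /\
  forall x, applyH T v psi x = E%:C * psi x.

Definition distinct_profiles (n : nat) (alpha : R) (psi : 'I_n -> L -> complex R)
    (B : 'I_n -> {set L}) : Prop :=
  alpha ^+ n <=
  \sum_(xs : {ffun 'I_n -> L} | [forall k, xs k \in B k])
     `| \det (\matrix_(j < n, k < n) (sqmod (psi j (xs k)))) |.

End Defs.

Section Prob.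
Variables (R : realType) (L : finType) (d : measure_display) (Om : measurableType d).

Definition sigma_others (V : L -> Om -> R) (x : L) : set (set Om) :=
  <<s [set S | exists y, y <> x /\ exists B : set R, measurable B /\ S = V y @^-1` B] >>.

(* For each x, the conditional distribution of V_x given (V_y)_{y<>x} is absolutely
   continuous w.r.t. Lebesgue measure, with a density f (a version of which is
   sigma_others-measurable in omega) bounded by rho:
   P(C /\ V_x in A) = int_C (int_A f(omega, t) dt) dP(omega)
   for every Borel A and every C in sigma((V_y)_{y<>x}). *)
Definition conditional_density_bounded (P : probability Om R) (V : L -> Om -> R)
    (rho : R) : Prop :=
  forall x : L, exists f : Om -> R -> R,
    (forall w, measurable_fun setT (f w)) /\
    (forall w t, 0 <= f w t <= rho) /\
    (forall t (B : set R), measurable B -> sigma_others V x ((fun w => f w t) @^-1` B)) /\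
    (forall (A : set R) (C : set Om), measurable A -> sigma_others V x C ->
       P (C `&` V x @^-1` A) =
       (\int[P]_(w in C) (\int[lebesgue_measure]_(t in A) (f w t)%:E))%E).

Definition event_distinct (T : L -> L -> complex R) (V : L -> Om -> R) (n : nat) (alpha : R)
    (I : 'I_n -> set R) (B : 'I_n -> {set L}) : set Om :=
  [set w | exists (E : 'I_n -> R) (psi : 'I_n -> L -> complex R),
     (forall j, I j (E j) /\ normalized_eigenfunction T (fun x => V x w) (E j) (psi j)) /\
     distinct_profiles alpha psi B].

End Prob.

(* Main.v *)
Require Import Defs.
From HB Require Import structures.
From mathcomp Require Import all_boot all_order all_algebra.
From mathcomp Require Import ring lra.
From mathcomp Require Import perm reals complex.
Set Implicit Arguments. Unset Strict Implicit. Unset Printing Implicit Defensive.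
Import Order.TTheory GRing.Theory Num.Theory.
Local Open Scope ring_scope.

(** For [n = 1] this is spectral averaging (the Wegner estimate).  For
    general [n] the derivative of the energies [E_j] in the potentials [V_(x_k)]
    is the matrix [|psi_j(x_k)|^2], so the determinants are Jacobians and the
    event probability is controlled by an area formula, provided that prescribed
    energies are attained by at most [n!] values of the [n] potentials.

    All of this is derived from the exact identity
      [\sum_k (v_k - v'_k) conj(psi'_j(x_k)) psi_j(x_k) = (E_j - E'_j) <psi'_j, psi_j>]
    between two potentials that differ only at the sites [x_k].

    - If the two potentials are distinct and have the same energies, then
      [det (conj(psi'_j(x_k)) psi_j(x_k))] vanishes.  By the Leibniz formula this
      determinant is an indefinite inner product of vectors of dimension [n!],
      so at most [n!] solutions with nonzero Jacobian exist; a quantitative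
      version (diagonal dominance) survives small perturbations of the energies.
    - Near a potential whose energies are simple, the identity is linear up to a
      small error, so the potentials with energies in a small cube of side [h]
      lie in a parallelepiped of volume about [h^n / |det|].

    Potentials are discretized in cubes of side [delta << h]; a cube has
    probability at most [(rho delta)^n] times that of its projection off the
    sites [x_k], so only finite sums of determinants have to be estimated, and
    neither measurability of eigenfunctions nor a change of variables in [R^n] is
    needed.  Degenerate energies form a null set by the same identity for [n = 2]. *)

(** * Packing unit cubes into a parallelepiped *)

Section Packing.
Variable R : realType.

(** Later bounds collect all error terms in one polynomial in a small parameter whose value at 0 is
    the desired limit; this lemma picks the parameter. *)
Lemma poly_le_near0 (p : {poly R}) (e : R) : 0 < e ->
  exists2 t0, 0 < t0 & forall t, 0 <= t <= t0 -> p.[t] <= p.[0] + e.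
Proof.
move=> e0; have [q Hq] : exists q, p = p.[0]%:P + 'X * q.
  have /factor_theorem [q Hq] : root (p - p.[0]%:P) 0.
    by rewrite /root !hornerE subrr.
  by exists q; rewrite polyC0 subr0 in Hq; rewrite mulrC -Hq addrC subrK.
have [b Hb] := poly_disk_bound q 1.
have b0 : 0 <= b by apply: le_trans (Hb 0 _) => //; rewrite normr0.
exists (Num.min 1 (e / (b + 1))).
  by rewrite lt_min ltr01 divr_gt0 //; lra.
move=> t /andP[t0]; rewrite le_min => /andP[t1 te].
rewrite Hq !hornerE lerD2l.
have : q.[t] <= b by apply: le_trans (ler_norm _) (Hb _ _); rewrite ger0_norm.
move=> qb; rewrite ler_pdivlMr in te; last lra.
apply: le_trans (ler_wpM2l t0 qb) _; nra.
Qed.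

Lemma size_int_itv (s : seq int) (x t : R) : 0 <= t -> uniq s ->
  (forall m, m \in s -> x <= m%:~R <= x + t) -> (size s)%:R <= t + 1.
Proof.
move=> t0 us Hs; pose c := Num.ceil x.
have cm m : m \in s -> 0 <= m - c.
  by move=> /Hs /andP[h _]; rewrite subr_ge0 ceil_le_int.
pose f (m : int) : nat := absz (m - c).
have inj : {in s &, injective f}.
  move=> a b sa sb /(congr1 (fun n : nat => n%:Z)).
  by rewrite /f !gez0_abs ?cm // => /addIr.
have u' : uniq (map f s) by rewrite map_inj_in_uniq.
have sub : {subset map f s <= iota 0 (Num.truncn t).+1}.
  move=> _ /mapP[m ms ->]; rewrite mem_iota /= add0n ltnS truncn_ge_nat //.
  have -> : (f m)%:R = (m - c)%:~R :> R.
    by rewrite -[in RHS](gez0_abs (cm _ ms)) .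
  have /andP[_ h] := Hs _ ms; have := ceil_ge x.
  by rewrite intrB; rewrite -/c; lra.
have := uniq_leq_size u' sub; rewrite size_map size_iota => h.
apply: (@le_trans _ _ ((Num.truncn t).+1)%:R); first by rewrite ler_nat.
by rewrite -natr1 lerD2r truncn_le.
Qed.

Lemma size_fibers (T U : eqType) (f : T -> U) (s : seq T) (k : R) :
  (forall u, u \in map f s -> (size [seq x <- s | f x == u])%:R <= k) ->
  (size s)%:R <= (size (undup (map f s)))%:R * k.
Proof.
move=> H; set V := undup _.
have -> : size s = (\sum_(u <- V) size [seq x <- s | f x == u])%N.
  under eq_bigr do rewrite size_filter -sum1_count big_mkcond.
  rewrite exchange_big /= -sum1_size; apply: eq_big_seq => x xs.
  rewrite -big_mkcond sum1_count /=.
  rewrite -(@eq_count _ (pred1 (f x))); last by move=> u /=; rewrite eq_sym.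
  by rewrite count_uniq_mem ?undup_uniq // mem_undup map_f.
rewrite natr_sum; apply: (@le_trans _ _ (\sum_(u <- V) k)).
  rewrite big_seq [X in _ <= X]big_seq; apply: ler_sum => u.
  by rewrite mem_undup; apply: H.
by rewrite big_const_seq count_predT iter_addr_0 mulr_natl.
Qed.

Lemma exists_slice (M : nat) (b t y : R) : (0 < M)%N -> b <= y <= b + M%:R * t ->
  exists s : 'I_M, b + s%:R * t <= y <= b + s.+1%:R * t.
Proof.
elim: M => // -[_ _ /andP[h1 h2]|M IH _ /andP[h1 h2]].
  by exists ord0 => //=; rewrite mul0r addr0 h1.
have [h|h] := leP y (b + M.+1%:R * t).
  have [|s hs] := IH isT; first by rewrite h1.
  by exists (widen_ord (leqnSn _) s).
by exists ord_max => //; rewrite h2 andbT ltW.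
Qed.

(** The upper half of lattice point asymptotics for a box pulled back by [A]. The threshold [d0] is
    uniform in the position [b] of the box, because the induction on the dimension applies the bound
    to shifted slices. *)
Definition lattice_count_le n (A : 'M[R]_n) :=
  forall (l : 'I_n -> R) (e : R), (forall i, 0 <= l i) -> 0 < e ->
  exists2 d0, 0 < d0 & forall d (b : 'I_n -> R) (Q : seq 'cV[int]_n),
    0 < d <= d0 -> uniq Q ->
    (forall m, m \in Q -> forall i,
       b i <= d * (A *m map_mx intr m) i 0 <= b i + l i) ->
    (size Q)%:R * d ^+ n <= (\prod_i l i) / `|\det A| + e.

Lemma lattice_count_perm n (A : 'M[R]_n) (s : 'S_n) :
  lattice_count_le (row_perm s A) -> lattice_count_le A.
Proof.
move=> H l e l0 e0; have [d0 d00 Hd] := H (l \o s) e (fun i => l0 _) e0.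
exists d0 => // d b Q hd uQ HQ.
have := Hd d (b \o s) Q hd uQ; rewrite row_permE det_mulmx det_perm normrM.
rewrite normrX normrN1 expr1n mul1r /=.
rewrite [in X in _ -> X](reindex_inj (@perm_inj _ s)) /=; apply.
move=> m mQ i; have := HQ m mQ (s i).
by rewrite -row_permE !mxE; under [in X in _ -> X]eq_bigr do rewrite mxE.
Qed.

(** Gaussian elimination with pivot [a] and Schur complement [S]. The box is cut into [M] thin slabs
    along coordinate 0. In one slab the lower coordinates of a lattice point satisfy a slightly
    widened box condition for [S], and once they are fixed the first coordinate lies in an
    interval. *)
Lemma lattice_count_step n (A : 'M[R]_(1 + n)) : A 0 0 != 0 ->
  (forall S : 'M[R]_n, \det S != 0 -> lattice_count_le S) ->
  \det A != 0 -> lattice_count_le A.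
Proof.
move=> a0 IH dA l e l0 e0.
set a := A 0 0 in a0.
pose k (i : 'I_n) := A (rshift 1 i) 0 / a.
pose S : 'M[R]_n := \matrix_(i, j) (A (rshift 1 i) (rshift 1 j) - k i * A 0 (rshift 1 j)).
have l00 : lshift n (0 : 'I_1) = 0 by apply/val_inj.
have defA : A = block_mx 1%:M 0 (\col_i k i) 1%:M *m
                block_mx a%:M (\row_j A 0 (rshift 1 j)) 0 S.
  rewrite mulmx_block !mul1mx !mul0mx !addr0 -[LHS]submxK.
  congr block_mx; apply/matrixP => i j.
  - by rewrite !mxE !ord1 l00 mulr1n.
  - by rewrite !mxE !ord1 l00.
  - rewrite !mxE !ord1 l00 (big_ord_recl 0) big_ord0 /= !mxE /= mulr1n addr0 divfK //.
  - rewrite !mxE (big_ord_recl 0) big_ord0 /= !mxE addr0 addrC subrK //.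
have detA : \det A = a * \det S.
  by rewrite defA det_mulmx det_lblock det_ublock !det1 !mul1r det_scalar expr1.
have dS : \det S != 0 by apply: contraNneq dA => h; rewrite detA h mulr0.
have mulS (u : 'cV[R]_(1 + n)) i : (S *m dsubmx u) i 0 =
    (A *m u) (rshift 1 i) 0 - k i * (A *m u) 0 0.
  rewrite !mxE !big_split_ord /= !(big_ord_recl 0) !big_ord0 /= !addr0 !l00.
  rewrite mulrDr opprD addrACA mulrA divfK // subrr add0r mulr_sumr -sumrB.
  by apply: eq_bigr => j _; rewrite !mxE; ring.
have mul0 (u : 'cV[R]_(1 + n)) : (A *m u) 0 0 = a * u 0 0 +
    \sum_j A 0 (rshift 1 j) * dsubmx u j 0.
  rewrite !mxE big_split_ord /= (big_ord_recl 0) big_ord0 addr0 l00.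
  by congr (_ + _); apply: eq_bigr => j _; rewrite mxE.
pose L0 := l 0; pose li i := l (rshift 1 i).
(* The final count as a function of [t], a slab having height [L0 * t]; at 0 it is the volume of the
   box divided by |det A|. *)
pose p : {poly R} := (((L0 / `|a|)%:P + 'X) *
   ((\prod_i ((li i)%:P + (2 * `|k i| * L0)%:P * 'X)) * (`|\det S|^-1)%:P + 'X)).
have [t0 t00 Ht0] := poly_le_near0 p e0.
pose M := (Num.truncn t0^-1).+1; pose t : R := M%:R^-1.
have M0 : 0 < M%:R :> R by rewrite ltr0n.
have t_gt0 : 0 < t by rewrite invr_gt0.
have tt0 : t <= t0.
  rewrite -[t0]invrK lef_pV2 ?posrE ?invr_gt0 //; apply: ltW.
  by rewrite -truncn_lt_nat // ltW // invr_gt0.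
have L00 : 0 <= L0 by apply: l0.
have pE x : p.[x] = (L0 / `|a| + x) *
    ((\prod_i (li i + 2 * `|k i| * L0 * x)) / `|\det S| + x).
  rewrite /p !hornerE horner_prod.
  by under eq_bigr do rewrite !hornerE.
have p0 : p.[0] = (\prod_i l i) / `|\det A|.
  rewrite pE !addr0; under eq_bigr do rewrite mulr0 addr0.
  have -> : \prod_i l i = L0 * \prod_i li i.
    rewrite big_split_ord /= (big_ord_recl 0) big_ord0 mulr1 l00.
    by congr (_ * _).
  by rewrite detA normrM invfM mulrACA.
have Hp : p.[t] <= (\prod_i l i) / `|\det A| + e.
  by rewrite -p0; apply: Ht0; rewrite ltW.
have [d1 d10 Hd1] := IH S dS (fun i => li i + 2 * `|k i| * L0 * t) t
   (fun i => addr_ge0 (l0 _) (mulr_ge0 (mulr_ge0 (mulr_ge0 (ler0n R 2) (normr_ge0 _)) L00) (ltW t_gt0))) t_gt0.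
(* Each of the [M] slabs has a rounding error [d]; since [M] is [1 / t], the bound [t * t] keeps
   their sum at most [t]. *)
exists (Num.min d1 (t * t)); first by rewrite lt_min d10 mulr_gt0.
move=> d b Q /andP[d_gt0]; rewrite le_min => /andP[dd1 dtt] uQ HQ.
pose tau := L0 * t.
have Mtau : M%:R * tau = L0 by rewrite /tau mulrC -mulrA mulVf ?mulr1 ?gt_eqF.
pose y (m : 'cV[int]_(1 + n)) := d * (A *m map_mx intr m) 0 0.
pose sl (s : 'I_M) := [seq m <- Q | b 0 + s%:R * tau <= y m <= b 0 + s.+1%:R * tau].
have HQ0 m : m \in Q -> exists s : 'I_M, m \in sl s.
  move=> mQ; have := HQ m mQ 0; rewrite -/(y m) -[l 0]/L0 -Mtau => h.
  have [s hs] := @exists_slice M _ _ _ isT h.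
  by exists s; rewrite mem_filter hs.
have sizeQ : (size Q)%:R <= \sum_(s < M) (size (sl s))%:R :> R.
  rewrite -natr_sum ler_nat; under eq_bigr do rewrite size_filter -sum1_count big_mkcond.
  rewrite exchange_big /= -sum1_size big_seq [X in (_ <= X)%N]big_seq.
  apply: leq_sum => m mQ; have [s] := HQ0 m mQ; rewrite mem_filter => /andP[hs _].
  by rewrite (bigD1 s) //= hs.
pose V := (\prod_i (li i + 2 * `|k i| * L0 * t)) / `|\det S| + t.
have V0 : 0 <= V.
  apply: addr_ge0 (ltW t_gt0); apply: divr_ge0 => //; apply: prodr_ge0 => i _.
  by rewrite addr_ge0 ?mulr_ge0 ?l0 // ltW.
have size_sl s : (size (sl s))%:R * d ^+ n.+1 <= (tau / `|a| + d) * V.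
  have fib u : u \in map dsubmx (sl s) ->
      (size [seq m <- sl s | dsubmx m == u])%:R <= tau / (`|a| * d) + 1.
    move=> _; set F := filter _ _.
    have -> : size F = size (map (fun m : 'cV[int]_(1 + n) => m 0 0) F) by rewrite size_map.
    pose z := (b 0 + s%:R * tau) / d - \sum_j A 0 (rshift 1 j) * (u j 0)%:~R.
    have in_F (m : 'cV[int]_(1 + n)) : m \in F -> z <= a * (m 0 0)%:~R <= z + tau / d.
      rewrite !mem_filter => /and3P[/eqP mu].
      rewrite /y mul0 mxE => h _.
      have -> : z = ((b 0 + s%:R * tau) / d) - \sum_j A 0 (rshift 1 j) * dsubmx (map_mx intr m : 'cV[R]_(1+n)) j 0.
        by rewrite /z -mu; congr (_ - _); apply: eq_bigr => j _; rewrite !mxE.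
      rewrite -natr1 mulrDl mul1r [X in _ && (_ <= X)]addrA in h.
      rewrite lerBlDr addrAC lerBrDr -mulrDl ler_pdivrMr // ler_pdivlMr //.
      by rewrite ![_ * d]mulrC.
    (* Division by [a] exchanges the endpoints when [a] is negative. *)
    apply: (@size_int_itv _ (if 0 < a then z / a else (z + tau / d) / a)).
    - by rewrite divr_ge0 ?mulr_ge0 ?(ltW d_gt0) // ltW.
    - rewrite map_inj_in_uniq; first by rewrite !filter_uniq.
      move=> m1 m2; rewrite !mem_filter => /and3P[/eqP h1 _ _] /and3P[/eqP h2 _ _] h.
      rewrite -[m1]vsubmxK -[m2]vsubmxK h1 h2; congr col_mx.
      by apply/matrixP => i j; rewrite !mxE !ord1 l00.
    - move=> _ /mapP[m mF ->]; have := in_F m mF.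
      have dn0 : d != 0 by rewrite gt_eqF.
      have z2 : z + tau / d = a * ((z + tau / d) / a) by rewrite [RHS]mulrC divfK.
      have z1 : z = a * (z / a) by rewrite [RHS]mulrC divfK.
      case: ltP => ha /andP[h1 h2].
        have -> : z / a + tau / (`|a| * d) = (z + tau / d) / a.
          by rewrite gtr0_norm //; field; rewrite a0 dn0.
        by rewrite z1 ler_pM2l // in h1; rewrite z2 ler_pM2l // in h2; rewrite h1.
      have {}ha : a < 0 by rewrite lt_neqAle a0.
      have -> : (z + tau / d) / a + tau / (`|a| * d) = z / a.
        by rewrite ltr0_norm //; field; rewrite a0 dn0.
      by rewrite z1 ler_nM2l // in h1; rewrite z2 ler_nM2l // in h2; rewrite h2.
  have Hsz := size_fibers fib.
  set U := undup _ in Hsz.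
  have HU : (size U)%:R * d ^+ n <= V.
    pose ys := b 0 + s%:R * tau.
    (* Inside the slab [k i * y m] stays within |k_i| tau of [k i * ys], which shifts the box and
       widens it by twice that amount. *)
    apply: (Hd1 d (fun i => b (rshift 1 i) - k i * ys - `|k i| * tau)).
    - by rewrite d_gt0.
    - exact: undup_uniq.
    - move=> u; rewrite mem_undup => /mapP[m]; rewrite mem_filter => /andP[hy mQ] -> i.
      have -> : map_mx intr (dsubmx m) = dsubmx (map_mx intr m : 'cV[R]_(1 + n)).
        by apply/matrixP => ? ?; rewrite !mxE.
      rewrite mulS.
      have /andP[h1 h2] := HQ m mQ (rshift 1 i).
      have hk : `|k i * (y m - ys)| <= `|k i| * tau.
        rewrite normrM ler_wpM2l // ger0_norm ?subr_ge0; last by case/andP: hy.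
        by case/andP: hy => _; rewrite -natr1 mulrDl mul1r addrA -/ys; lra.
      set X := (A *m _) _ _ in h1 h2 *.
      have -> : d * (X - k i * (A *m map_mx intr m) 0 0) = d * X - k i * y m.
        by rewrite /y; ring.
      have -> : 2 * `|k i| * L0 * t = 2 * (`|k i| * tau) by rewrite /tau; ring.
      move: hk; rewrite ler_norml mulrBr /li => /andP[h3 h4].
      clearbody tau ys X; clear -h1 h2 h3 h4.
      by apply/andP; split; lra.
  have U0 : 0 <= tau / `|a| + d by rewrite addr_ge0 ?divr_ge0 ?mulr_ge0 // ltW.
  apply: le_trans (_ : (size U)%:R * (tau / (`|a| * d) + 1) * d ^+ n.+1 <= _).
    by rewrite ler_wpM2r // exprn_ge0 // ltW.
  have -> : (size U)%:R * (tau / (`|a| * d) + 1) * d ^+ n.+1 =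
     (tau / `|a| + d) * ((size U)%:R * d ^+ n).
    by rewrite exprS; field; rewrite normr_eq0 a0 gt_eqF.
  by rewrite ler_wpM2l.
apply: le_trans Hp; rewrite pE -/V.
apply: le_trans (_ : \sum_(s < M) (size (sl s))%:R * d ^+ n.+1 <= _).
  by rewrite -mulr_suml ler_wpM2r // exprn_ge0 // ltW.
apply: le_trans (_ : \sum_(s < M) ((tau / `|a| + d) * V) <= _).
  by apply: ler_sum => s _; apply: size_sl.
rewrite sumr_const card_ord -[_ *+ M]mulr_natl mulrA ler_wpM2r //.
rewrite mulrDr mulrA Mtau lerD2l.
apply: le_trans (_ : M%:R * (t * t) <= _); first by rewrite ler_wpM2l // ltW.
by rewrite mulrA mulfV ?mul1r ?gt_eqF.
Qed.

(** Induction on the dimension, after a row swap that makes the pivot nonzero. *)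
Lemma lattice_count n (A : 'M[R]_n) : \det A != 0 -> lattice_count_le A.
Proof.
elim: n A => [|n IH] A dA.
  move=> l e l0 e0; exists 1 => // d b Q _ uQ _.
  rewrite expr0 mulr1 det_mx00 normr1 big_ord0 divr1.
  apply: le_trans (_ : 1 <= _); last by rewrite lerDl ltW.
  rewrite (ler_nat _ _ 1); apply: (@uniq_leq_size _ _ [:: 0]) => // x _.
  by rewrite inE; apply/eqP/matrixP => -[].
have [i Ai] : exists i, A i 0 != 0.
  apply/existsP; rewrite -negb_forall; apply: contraNN dA => /forallP H.
  rewrite (expand_det_col A 0) big1 // => i _.
  by rewrite (eqP (H i)) mul0r.
apply: (@lattice_count_perm _ _ (tperm 0 i)).
apply: lattice_count_step IH _; first by rewrite mxE tpermL.
by rewrite row_permE det_mulmx mulf_neq0 // det_perm signr_eq0.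
Qed.

(** Volume comparison by counting: each unit cube is subdivided into [K ^ n] cubes whose corners
    belong to a lattice of mesh [1 / K], so [lattice_count] bounds the number of unit cubes up to an
    arbitrary [e]. *)
Lemma packing n (A : 'M[R]_n) (Q : seq 'cV[int]_n) (b l : 'I_n -> R) :
  uniq Q -> \det A != 0 -> (forall i, 0 <= l i) ->
  (forall m, m \in Q -> forall u : 'cV[R]_n,
     (forall i, (m i 0)%:~R <= u i 0 <= (m i 0)%:~R + 1) ->
     forall i, b i <= (A *m u) i 0 <= b i + l i) ->
  (size Q)%:R * `|\det A| <= \prod_i l i.
Proof.
move=> uQ dA l0 HQ.
rewrite -ler_pdivlMr ?normr_gt0 //; apply/ler_addgt0Pr => e e0.
have [d0 d00 Hd] := lattice_count dA l0 e0.
pose K := (Num.truncn d0^-1).+1; pose d : R := K%:R^-1.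
have K0 : 0 < K%:R :> R by rewrite ltr0n.
have d_gt0 : 0 < d by rewrite invr_gt0.
have dd0 : d <= d0.
  rewrite -[d0]invrK lef_pV2 ?posrE ?invr_gt0 //; apply: ltW.
  by rewrite -truncn_lt_nat // ltW // invr_gt0.
pose f (m : 'cV[int]_n) (c : {ffun 'I_n -> 'I_K}) : 'cV[int]_n :=
  \col_i (m i 0 * K%:Z + (c i : nat)%:Z).
pose QK := [seq f m c | m <- Q, c <- enum {: {ffun 'I_n -> 'I_K}}].
have := Hd d b QK; rewrite d_gt0 dd0 size_allpairs -cardE card_ffun !card_ord.
rewrite natrM natrX -mulrA -exprMn mulfV ?gt_eqF // expr1n mulr1; apply => //.
  apply: allpairs_uniq => //; first exact: enum_uniq.
  move=> [m c] [m' c'] _ _ /= /matrixP E.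
  have E' i : (m i 0 = m' i 0) /\ c i = c' i.
    have := E i 0; rewrite !mxE => Ei.
    have Kn : K%:Z != 0 by [].
    have h x (y : 'I_K) : (x * K%:Z + (y : nat)%:Z) %/ K%:Z = x :> int.
      by rewrite divzMDl // divz_small ?addr0 //=; apply: ltn_ord.
    have Ex : m i 0 = m' i 0 by rewrite -(h (m i 0) (c i)) Ei h.
    by split=> //; apply/val_inj; move: Ei; rewrite Ex => /addrI [].
  congr pair; first by apply/matrixP => i j; rewrite ord1; case: (E' i).
  by apply/ffunP => i; case: (E' i).
move=> _ /allpairsP[[m c] [mQ _ ->]] i /=.
have := HQ m mQ (d *: map_mx intr (f m c)) _ i.
rewrite -scalemxAr [X in _ <= X <= _]mxE; apply=> j; rewrite !mxE.
rewrite intrD intrM mulrDr mulrCA mulVf ?gt_eqF // mulr1 lerDl lerD2l.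
rewrite mulr_ge0 ?(ltW d_gt0) //= mulrC ler_pdivrMr // mul1r -[K%:R]/(K%:Z%:~R).
by rewrite ler_nat ltnW.
Qed.
End Packing.

(** * Determinant bounds *)

Section DetBounds.
Variable F : numFieldType.

Lemma norm_det_le n (A : 'M[F]_n) : (forall i j, `|A i j| <= 1) ->
  `|\det A| <= n`!%:R.
Proof.
move=> A1; rewrite /determinant; apply: le_trans (ler_norm_sum _ _ _) _.
rewrite -card_Sn -sum1_card natr_sum.
rewrite [X in _ <= X](eq_bigl xpredT) //.
apply: ler_sum => s _.
rewrite normrM normrX normrN1 expr1n mul1r normr_prod.
by apply: prodr_ile1 => i _; rewrite normr_ge0 A1.
Qed.

Lemma norm_adj_le n (A : 'M[F]_n) i j : (forall i j, `|A i j| <= 1) ->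
  `|\adj A i j| <= n`!%:R.
Proof.
move=> A1; rewrite mxE /cofactor normrM normrX normrN1 expr1n mul1r.
apply: le_trans (norm_det_le _) _; first by move=> k l; rewrite !mxE.
by rewrite ler_nat; case: n A i j A1 => // n *; rewrite factS leq_pmull.
Qed.

(** Cramer's rule via the adjugate. It recovers changes of the potentials from changes of the
    energies, given a lower bound on the determinant. *)
Lemma cramer_bound n (A : 'M[F]_n) (w : 'cV[F]_n) k : (forall i j, `|A i j| <= 1) ->
  `|\det A| * `|w k 0| <= n`!%:R * \sum_j `|(A *m w) j 0|.
Proof.
move=> A1; rewrite -normrM.
have -> : \det A * w k 0 = (\adj A *m (A *m w)) k 0.
  by rewrite mulmxA mul_adj_mx mul_scalar_mx mxE.
rewrite mxE; apply: le_trans (ler_norm_sum _ _ _) _.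
by rewrite mulr_sumr; apply: ler_sum => j _; rewrite normrM ler_wpM2r // norm_adj_le.
Qed.

Lemma prod_lipschitz (I : Type) (s : seq I) (a b : I -> F) (t : F) :
  (forall i, `|a i| <= 1) -> (forall i, `|b i| <= 1) ->
  (forall i, `|a i - b i| <= t) ->
  `|\prod_(i <- s) a i - \prod_(i <- s) b i| <= (size s)%:R * t.
Proof.
move=> a1 b1 ab; elim: s => [|i s IH]; first by rewrite !big_nil subrr normr0 mul0r.
rewrite !big_cons /= -natr1.
have -> : a i * \prod_(j <- s) a j - b i * \prod_(j <- s) b j =
  a i * (\prod_(j <- s) a j - \prod_(j <- s) b j) + (a i - b i) * \prod_(j <- s) b j.
  by ring.
rewrite [X in _ <= X]mulrDl [X in _ <= _ + X]mul1r; apply: le_trans (ler_normD _ _) _; apply: lerD; rewrite normrM.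
  by rewrite -[X in _ <= X]mul1r; apply: ler_pM.
rewrite -[X in _ <= X]mulr1; apply: ler_pM => //.
by rewrite normr_prod prodr_ile1 // => j _; rewrite normr_ge0 b1.
Qed.

Lemma det_lipschitz n (A B : 'M[F]_n) (t : F) :
  (forall i j, `|A i j| <= 1) -> (forall i j, `|B i j| <= 1) ->
  (forall i j, `|A i j - B i j| <= t) ->
  `|\det A - \det B| <= n`!%:R * (n%:R * t).
Proof.
move=> A1 B1 AB; rewrite /determinant -sumrB; apply: le_trans (ler_norm_sum _ _ _) _.
rewrite -card_Sn -sum1_card natr_sum mulr_suml.
rewrite [X in _ <= X](eq_bigl xpredT) //.
apply: ler_sum => s _; rewrite mul1r -mulrBr normrM normrX normrN1 expr1n mul1r.
have sz : size (index_enum 'I_n) = n by rewrite -[RHS]card_ord cardE enumT.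
by rewrite -[in X in _ <= X]sz; apply: prod_lipschitz.
Qed.

(** For a vector in the left kernel, each column equation bounds the diagonal term by the
    off-diagonal ones; the sum over all columns contradicts [n%:R * theta < eta]. *)
Lemma diag_dominant_det n (G : 'M[F]_n) (eta theta : F) : 0 <= theta ->
  (forall i, eta <= `|G i i|) -> (forall i j, i != j -> `|G i j| <= theta) ->
  n%:R * theta < eta -> \det G != 0.
Proof.
move=> th0 Gd Go lt; apply/det0P => -[v v0 vG].
have S0 : 0 < \sum_i `|v 0 i|.
  rewrite lt_neqAle sumr_ge0 // andbT eq_sym.
  apply: contraNneq v0 => /psumr_eq0P H; apply/eqP/matrixP => i j.
  by rewrite ord1 mxE; apply/eqP; rewrite -normr_eq0 H.
have : eta * \sum_i `|v 0 i| <= (n%:R * theta) * \sum_i `|v 0 i|.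
  rewrite mulr_sumr; apply: le_trans (_ : \sum_i \sum_j `|v 0 j| * theta <= _).
    apply: ler_sum => i _; have /matrixP/(_ 0 i) := vG.
    rewrite !mxE (bigD1 i) //= => /eqP; rewrite addr_eq0 => /eqP E.
    apply: le_trans (_ : `|v 0 i * G i i| <= _).
      by rewrite normrM mulrC ler_wpM2l.
    rewrite E normrN; apply: le_trans (ler_norm_sum _ _ _) _.
    rewrite [X in _ <= X](bigD1 i) //= -[X in X <= _]add0r; apply: lerD.
      by rewrite mulr_ge0.
    by apply: ler_sum => j ji; rewrite normrM ler_wpM2l // Go.
  by rewrite sumr_const card_ord -mulr_suml -[X in X <= _]mulr_natl -mulrA [theta * _]mulrC.
by rewrite ler_pM2r // => /(lt_le_trans lt); rewrite ltxx.
Qed.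

(* By the Leibniz formula the Gram-type matrix factors through the space of
   functions on the symmetric group, so its rank is at most [n`!]. *)
Lemma det_hadamard_gram n M (U W : 'I_M -> 'M[F]_n) : (n`! < M)%N ->
  \det (\matrix_(s < M, t < M) \det (\matrix_(j, k) (U s j k * W t j k))) = 0.
Proof.
move=> ltM; apply/eqP; rewrite -[_ == _]negbK -unitfE -unitmxE; apply/negP => uG.
pose N := #|{: 'S_n}|.
pose X : 'M[F]_(M, N) := \matrix_(s, i) \prod_j U s j ((enum_val i : 'S_n) j).
pose Y : 'M[F]_(N, M) := \matrix_(i, t)
  ((-1) ^+ (enum_val i : 'S_n) * \prod_j W t j ((enum_val i : 'S_n) j)).
have EG : \matrix_(s < M, t < M) \det (\matrix_(j, k) (U s j k * W t j k)) = X *m Y.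
  apply/matrixP => s t; rewrite !mxE /determinant.
  rewrite (reindex (@enum_val _ {: 'S_n})) /=; last first.
    by apply/onW_bij/enum_val_bij.
  apply: eq_bigr => i _; rewrite !mxE mulrCA; congr (_ * _).
  by rewrite -big_split /=; apply: eq_bigr => j _; rewrite mxE.
have : (\rank (X *m Y) <= N)%N by apply: leq_trans (mxrankM_maxl _ _) (rank_leq_col _).
rewrite -EG mxrank_unit // /N => h; move: ltM.
have -> : n`! = #|{: 'S_n}| by rewrite -card_Sn; apply: eq_card => s; rewrite !inE.
by rewrite ltnNge h.
Qed.

(** Among more than n! indices, the first n! + 1 would have a Gram-type matrix that is singular by
    [det_hadamard_gram] and invertible by diagonal dominance. *)
Lemma gram_card_le n M (U W : 'I_M -> 'M[F]_n) (eta theta : F) : 0 <= theta ->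
  (forall s, eta <= `|\det (\matrix_(j, k) (U s j k * W s j k))|) ->
  (forall s t, s != t -> `|\det (\matrix_(j, k) (U s j k * W t j k))| <= theta) ->
  (n`!.+1)%:R * theta < eta -> (M <= n`!)%N.
Proof.
move=> th0 Hd Ho lt; rewrite leqNgt; apply/negP => ltM.
pose f := widen_ord ltM.
have := @det_hadamard_gram n _ (U \o f) (W \o f) (ltnSn _).
apply/eqP; apply: (@diag_dominant_det _ _ eta theta) => //.
  by move=> i; rewrite mxE; apply: Hd.
by move=> i j ij; rewrite mxE; apply: Ho; apply: contraNneq ij => /(congr1 val) /= /val_inj ->.
Qed.

End DetBounds.

(** * Green identity and nearby eigenfunctions *)

Section Modulus.
Local Open Scope complex_scope.
Variable R : realType.
Implicit Types z w : complex R.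
Import Normc.

Lemma norm_normc z : `|z| = (normc z)%:C.
Proof. by case: z. Qed.

Lemma normc_ge0 z : 0 <= normc z.
Proof. by case: z => a b; apply: sqrtr_ge0. Qed.

Lemma normcD z w : normc (z + w) <= normc z + normc w.
Proof. by rewrite -lecR rmorphD /= -!norm_normc ler_normD. Qed.

Lemma normcN z : normc (- z) = normc z.
Proof. by apply: complexI; rewrite /= -!norm_normc normrN. Qed.

Lemma normc_sum (I : Type) (s : seq I) (P : pred I) (f : I -> complex R) :
  normc (\sum_(i <- s | P i) f i) <= \sum_(i <- s | P i) normc (f i).
Proof.
elim/big_ind2: _ => [|z a w b za wb|i _]; rewrite ?normc0 //.
by apply: le_trans (normcD _ _) _; apply: lerD.
Qed.

Lemma normc_real (a : R) : normc a%:C = `|a|.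
Proof. by rewrite /= expr0n /= addr0 sqrtr_sqr. Qed.

Lemma normc_conj z : normc z^*%C = normc z.
Proof. by case: z => a b /=; rewrite sqrrN. Qed.

Lemma sqmodE z : sqmod z = normc z ^+ 2.
Proof. by case: z => a b; rewrite /sqmod /= sqr_sqrtr // addr_ge0 ?sqr_ge0. Qed.

Lemma sqmodJ z : (sqmod z)%:C = z^*%C * z.
Proof. by rewrite /sqmod add_Re2_Im2 mulrC -sqr_normc. Qed.

Lemma normc_eq0 z : (normc z == 0) = (z == 0).
Proof. by apply/eqP/eqP => [/eq0_normc|->] //; rewrite normc0. Qed.

Lemma sqmod_ge0 z : 0 <= sqmod z.
Proof. by rewrite sqmodE exprn_ge0 // normc_ge0. Qed.

Lemma conjcM z w : (z * w)^*%C = z^*%C * w^*%C.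
Proof. exact: rmorphM. Qed.

Lemma conjcD z w : (z + w)^*%C = z^*%C + w^*%C.
Proof. exact: rmorphD. Qed.

Lemma conjcN z : (- z)^*%C = - z^*%C.
Proof. exact: rmorphN. Qed.

Lemma conjc_sum (I : Type) (s : seq I) (P : pred I) (f : I -> complex R) :
  (\sum_(i <- s | P i) f i)^*%C = \sum_(i <- s | P i) (f i)^*%C.
Proof. exact: (rmorph_sum (@conjc R)). Qed.

End Modulus.

(** * Hermitian pairing, Green identity, comparison of eigenfunctions *)

Section Spectral.
Local Open Scope complex_scope.
Variables (R : realType) (L : finType).
Local Notation C := (complex R).
Import Normc.
Implicit Types (phi psi : L -> C) (v : L -> R) (E : R).

Definition cip phi psi : C := \sum_x (phi x)^*%C * psi x.

Lemma cipJ phi psi : (cip phi psi)^*%C = cip psi phi.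
Proof.
rewrite /cip conjc_sum; apply: eq_bigr => x _.
by rewrite conjcM conjcK mulrC.
Qed.

Lemma cip_self phi : cip phi phi = (\sum_x sqmod (phi x))%:C.
Proof. by rewrite rmorph_sum /=; apply: eq_bigr => x _; rewrite sqmodJ. Qed.

Lemma cipDr phi psi1 psi2 (a b : C) :
  cip phi (fun x => a * psi1 x + b * psi2 x) = a * cip phi psi1 + b * cip phi psi2.
Proof. by rewrite /cip !mulr_sumr -big_split; apply: eq_bigr => x _ /=; ring. Qed.

(** The arithmetic-geometric mean inequality at each site takes the place of Cauchy-Schwarz. *)
Lemma normc_prod_le psi1 psi2 : \sum_x sqmod (psi1 x) = 1 -> \sum_x sqmod (psi2 x) = 1 ->
  \sum_x normc ((psi1 x)^*%C * psi2 x) <= 1.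
Proof.
move=> h1 h2; have : \sum_x (sqmod (psi1 x) + sqmod (psi2 x)) / 2 = 1.
  by rewrite -mulr_suml big_split /= h1 h2; lra.
move=> <-; apply: ler_sum => x _; rewrite normcM normc_conj !sqmodE.
have := sqr_ge0 (normc (psi1 x) - normc (psi2 x)); rewrite sqrrB; lra.
Qed.

Lemma sqmod_le1 psi x : \sum_x sqmod (psi x) = 1 -> sqmod (psi x) <= 1.
Proof.
move=> <-; rewrite (bigD1 x) //= lerDl sumr_ge0 // => y _; exact: sqmod_ge0.
Qed.

Lemma normc_le1 psi x : \sum_x sqmod (psi x) = 1 -> normc (psi x) <= 1.
Proof.
move=> /sqmod_le1 => /(_ x); rewrite sqmodE expr_le1 // normc_ge0 //.
Qed.

Variable T : L -> L -> C.

Lemma applyH_lin v phi psi (a b : C) x :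
  applyH T v (fun x => a * phi x + b * psi x) x =
  a * applyH T v phi x + b * applyH T v psi x.
Proof.
rewrite /applyH [a * (_ + _)]mulrDr [b * (_ + _)]mulrDr !mulr_sumr addrACA -big_split.
by congr (_ + _); [apply: eq_bigr => y _ /=|]; ring.
Qed.

Hypothesis hermT : hermitian_kernel T.

Lemma hermitian_cip v phi psi :
  cip phi (applyH T v psi) = cip (applyH T v phi) psi.
Proof.
rewrite /cip /applyH.
under eq_bigr do rewrite mulrDr mulr_sumr.
under [RHS]eq_bigr do rewrite conjcD conjcM conjc_real mulrDl conjc_sum mulr_suml.
rewrite !big_split /= exchange_big /=; congr (_ + _).
  apply: eq_bigr => x _; apply: eq_bigr => y _.
  by rewrite conjcM (hermT x y); ring.
by apply: eq_bigr => x _; ring.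
Qed.

(** Pair the equation for [psi] with [psi'] and the one for [psi'] with [psi]; on subtraction the
    hermitian part [T] cancels. *)
Lemma green_identity v v' E E' psi psi' :
  (forall x, applyH T v psi x = E%:C * psi x) ->
  (forall x, applyH T v' psi' x = E'%:C * psi' x) ->
  \sum_x (v x - v' x)%:C * ((psi' x)^*%C * psi x) = (E - E')%:C * cip psi' psi.
Proof.
move=> H H'.
have e1 : cip psi' (applyH T v psi) = E%:C * cip psi' psi.
  by rewrite /cip mulr_sumr; apply: eq_bigr => x _; rewrite H; ring.
have e2 : cip (applyH T v' psi') psi = E'%:C * cip psi' psi.
  by rewrite /cip mulr_sumr; apply: eq_bigr => x _; rewrite H' conjcM conjc_real; ring.
rewrite rmorphB mulrBl -e1 -e2 -hermitian_cip /cip -sumrB; apply: eq_bigr => x _.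
by rewrite /applyH rmorphB /=; ring.
Qed.

(* Only the sites [xs k] matter when the two potentials agree to within [delta] elsewhere. *)
Lemma green_local n (xs : 'I_n -> L) v v' E E' psi psi' (delta : R) :
  injective xs ->
  normalized_eigenfunction T v E psi -> normalized_eigenfunction T v' E' psi' ->
  0 <= delta -> (forall y, (forall k, y != xs k) -> `|v y - v' y| <= delta) ->
  normc (\sum_k (v (xs k) - v' (xs k))%:C * ((psi' (xs k))^*%C * psi (xs k))
         - (E - E')%:C * cip psi' psi) <= delta.
Proof.
move=> inj [n1 H] [n2 H'] d0 Hd; rewrite -(green_identity H H').
rewrite -[X in X - _](@big_imset _ _ _ _ _ xs xpredT
  (fun x => (v x - v' x)%:C * ((psi' x)^*%C * psi x))) /=; last by move=> i j _ _ /inj.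
rewrite [X in _ - X](bigID (mem (xs @: 'I_n))) /=.
rewrite opprD addrA subrr sub0r normcN.
apply: le_trans (normc_sum _ _ _) _.
apply: le_trans (_ : delta * \sum_(x | x \notin xs @: 'I_n) normc ((psi' x)^*%C * psi x) <= _).
  rewrite mulr_sumr; apply: ler_sum => x hx; rewrite normcM normc_real.
  rewrite ler_wpM2r ?normc_ge0 // Hd // => k; apply: contraNneq hx => ->.
  exact: imset_f.
rewrite -[X in _ <= X]mulr1 ler_wpM2l //; apply: le_trans (normc_prod_le n2 n1).
rewrite [X in _ <= X](bigID (mem (xs @: 'I_n))) /= lerDr.
by apply: sumr_ge0 => x _; apply: normc_ge0.
Qed.


(* [K] bounds the inverse of [H - E + psi psi^*] in sup norm: such a [K] exists
   exactly when [E] is a simple eigenvalue. *)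
Definition resolvent_bound (v : L -> R) E psi (K : R) : Prop :=
  forall phi (s : R),
    (forall x, normc (applyH T v phi x - E%:C * phi x + cip psi phi * psi x) <= s) ->
    forall x, normc (phi x) <= K * s.

(** The resolvent bound at [v'] is applied to the component of [psi] orthogonal to [psi']: the
    rank-one term vanishes and the residual is [(E - E') - (v x - v' x)] times [psi x]. *)
Lemma close_eigvec v v' E E' psi psi' (K r h : R) :
  normalized_eigenfunction T v E psi -> normalized_eigenfunction T v' E' psi' ->
  resolvent_bound v' E' psi' K ->
  (forall x, `|v x - v' x| <= r) -> `|E - E'| <= h ->
  forall x, normc (psi x - cip psi' psi * psi' x) <= K * (r + h).
Proof.
move=> [n1 H] [n2 H'] HK Hv HE.
set c := cip psi' psi.
have eqF : (fun x => psi x - c * psi' x) = (fun x => 1 * psi x + (- c) * psi' x).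
  by apply: boolp.funext => y; ring.
apply: (HK (fun x => psi x - c * psi' x)) => x.
have -> : cip psi' (fun x => psi x - c * psi' x) = 0.
  by rewrite eqF cipDr cip_self n2 -/c; ring.
have -> : applyH T v' (fun x => psi x - c * psi' x) x =
    applyH T v' psi x - c * (E'%:C * psi' x).
  by rewrite eqF applyH_lin H'; ring.
have -> : applyH T v' psi x = E%:C * psi x - (v x - v' x)%:C * psi x.
  by rewrite -H /applyH rmorphB /=; ring.
have -> : E%:C * psi x - (v x - v' x)%:C * psi x - c * (E'%:C * psi' x) -
   E'%:C * (psi x - c * psi' x) + 0 * psi' x = ((E - E') - (v x - v' x))%:C * psi x.
  by rewrite [X in _ = X * _]rmorphB [X in _ = (X - _) * _]rmorphB /=; ring.
rewrite normcM normc_real; apply: le_trans (_ : (r + h) * 1 <= _); last by rewrite mulr1.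
apply: ler_pM; rewrite ?normc_ge0 // ?normc_le1 //.
by apply: le_trans (ler_normB _ _) _; rewrite addrC lerD.
Qed.

Section Close.
Variables (psi psi' : L -> C) (kappa : R).
Hypotheses (n1 : \sum_x sqmod (psi x) = 1) (n2 : \sum_x sqmod (psi' x) = 1).
Hypothesis close : forall x, normc (psi x - cip psi' psi * psi' x) <= kappa.
Let c := cip psi' psi.

(** Pythagoras: the squared norm of [psi - c psi'] is 1 - |c|^2. *)
Lemma close_normc_cip : normc c ^+ 2 <= 1 /\ 1 - #|L|%:R * kappa ^+ 2 <= normc c ^+ 2.
Proof.
have E : normc c ^+ 2 = 1 - \sum_x sqmod (psi x - c * psi' x).
  have -> : \sum_x sqmod (psi x - c * psi' x) = 1 - normc c ^+ 2; last by ring.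
  apply: complexI; rewrite -(cip_self (fun x => psi x - c * psi' x)).
  have -> : (fun x => psi x - c * psi' x) = (fun x => 1 * psi x + (- c) * psi' x).
    by apply: boolp.funext => y; ring.
  have swap f g : cip f g = (cip g f)^*%C by rewrite cipJ.
  rewrite cipDr swap cipDr cip_self n1 [X in _ + _ * X]swap cipDr cip_self n2.
  rewrite [cip psi psi']swap -/c -sqmodE [RHS]rmorphB [X in _ - X]sqmodJ.
  rewrite !conjcD !conjcM !conjcN !conjcK !conjc1 ?rmorph1.
  by ring.
split; rewrite E; first by rewrite lerBlDr lerDl sumr_ge0 // => x _; apply: sqmod_ge0.
rewrite lerD2l lerN2; apply: le_trans (_ : \sum_(x : L) kappa ^+ 2 <= _).
  by apply: ler_sum => x _; rewrite sqmodE lerXn2r ?nnegrE ?normc_ge0 //; apply: le_trans (close x); apply: normc_ge0.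
by rewrite sumr_const -[_ *+ _]mulr_natl.
Qed.

(** Only moduli enter, so the phase of [c] drops out: compare through the modulus of [c * psi' x],
    with |c| close to 1. *)
Lemma close_sqmod x : 0 <= kappa ->
  `|sqmod (psi x) - sqmod (psi' x)| <= 2 * kappa + #|L|%:R * kappa ^+ 2.
Proof.
move=> k0; have [c1 c2] := close_normc_cip.
have a1 := normc_le1 x n1; have b1 := normc_le1 x n2; have d1 := close x.
have a0 := normc_ge0 (psi x); have b0 := normc_ge0 (psi' x); have c0 := normc_ge0 c.
have cb := normcM c (psi' x).
have t1 : normc (psi x) <= normc (c * psi' x) + kappa.
  rewrite -[psi x in X in X <= _](subrK (c * psi' x)) addrC.
  by apply: le_trans (normcD _ _) _; rewrite lerD2l.
have t2 : normc (c * psi' x) <= normc (psi x) + kappa.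
  have -> : c * psi' x = psi x - (psi x - c * psi' x) by ring.
  by apply: le_trans (normcD _ _) _; rewrite normcN lerD2l.
rewrite !sqmodE; rewrite cb in t1 t2; move: c1 c2 a1 b1 a0 b0 c0 t1 t2 k0 {d1 cb}.
set N : R := #|L|%:R * kappa ^+ 2.
move: (normc (psi x)) (normc (psi' x)) (normc c) => a b m c1 c2 a1 b1 a0 b0 m0 t1 t2 k0.
have m1 : m <= 1 by rewrite -(@expr_le1 _ 2).
have mb1 : m * b <= 1 by nra.
have mb0 : 0 <= m * b by nra.
have h1 : `|a ^+ 2 - (m * b) ^+ 2| <= 2 * kappa.
  by rewrite subr_sqr normrM mulrC; apply: ler_pM => //; rewrite ler_norml; apply/andP; split; lra.
have h2 : `|(m * b) ^+ 2 - b ^+ 2| <= N.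
  have bb0 := sqr_ge0 b; have bb1 : b ^+ 2 <= 1 by rewrite expr_le1.
  by rewrite exprMn ler_norml; apply/andP; split; nra.
apply: le_trans (lerD h1 h2).
have -> : a ^+ 2 - b ^+ 2 = (a ^+ 2 - (m * b) ^+ 2) + ((m * b) ^+ 2 - b ^+ 2) by ring.
exact: ler_normD.
Qed.
End Close.
End Spectral.

(** * Potentials with energies in a small cube *)

(** A maximal separated subset covers [A]. It stands in for a set of class representatives, as
    [near] is not assumed transitive. *)
Lemma exists_separated (I : finType) (A : {set I}) (near : rel I) :
  reflexive near -> symmetric near ->
  exists2 S : {set I}, S \subset A &
    (forall q, q \in A -> exists2 q', q' \in S & near q q') /\
    (forall q q', q \in S -> q' \in S -> q != q' -> ~~ near q q').
Proof.
move=> nrefl nsym.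
pose P (S : {set I}) := (S \subset A) &&
  [forall q in S, forall q' in S, (q != q') ==> ~~ near q q'].
have P0 : P set0.
  by rewrite /P sub0set; apply/forall_inP => q; rewrite inE.
have [S /maxsetP[/andP[SA /forall_inP Ssep] Smax] _] := maxset_exists P0.
have sep q q' : q \in S -> q' \in S -> q != q' -> ~~ near q q'.
  by move=> qS q'S; have /forall_inP /(_ q' q'S) /implyP := Ssep q qS.
exists S => //; split=> // q qA; apply/exists_inP; rewrite -[X in is_true X]negbK negb_exists_in.
apply/negP => /forall_inP far.
have : P (q |: S).
  rewrite /P subUset sub1set qA SA; apply/forall_inP => x xS; apply/forall_inP => y yS.
  apply/implyP; move: xS yS; rewrite !inE.
  case/orP=> [/eqP->|xS] /orP[/eqP->|yS]; rewrite ?eqxx //.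
  - by move=> _; apply: far.
  - by move=> _; rewrite nsym; apply: far.
  - exact: sep.
move=> /Smax /(_ (subsetUr _ _)) E; have qS : q \in S by rewrite -E setU11.
by have := far q qS; rewrite nrefl.
Qed.

Section Linearize.
Local Open Scope complex_scope.
Variables (R : realType) (L : finType).
Local Notation C := (complex R).
Import Normc.
Variable T : L -> L -> C.
Hypothesis hermT : hermitian_kernel T.

(** First-order perturbation theory. In the Green identity [psi] is replaced by [c * psi'] at cost
    [kappa]; division by [c], of modulus at least 1/2, yields the factor 2. *)
Lemma linearized_energy n (xs : 'I_n -> L) (v v' : L -> R) E E' psi psi' (delta kappa : R) :
  injective xs ->
  normalized_eigenfunction T v E psi -> normalized_eigenfunction T v' E' psi' ->
  0 <= delta -> (forall y, (forall k, y != xs k) -> `|v y - v' y| <= delta) ->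
  0 <= kappa -> #|L|%:R * kappa ^+ 2 <= 3 / 4 ->
  (forall x, normc (psi x - cip psi' psi * psi' x) <= kappa) ->
  `|\sum_k sqmod (psi' (xs k)) * (v (xs k) - v' (xs k)) - (E - E')| <=
  2 * (delta + kappa * \sum_k `|v (xs k) - v' (xs k)|).
Proof.
move=> inj H H' d0 Hd k0 Lk Hc.
have := green_local hermT inj H H' d0 Hd.
case: H => n1 _; case: H' => n2 _.
have [_ c2] := close_normc_cip n1 n2 Hc.
set c := cip psi' psi in c2 Hc *; set S := \sum_k _ * _ => HG.
have chalf : 1 / 2 <= normc c.
  rewrite leNgt; apply/negP => h; have := normc_ge0 c.
  by move: c2 h Lk; move: (normc c) (#|L|%:R * _) => a b; nra.
set X := (\sum_k _ - _).
have EX : c * X%:C = (S - (E - E')%:C * c) -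
   \sum_k (v (xs k) - v' (xs k))%:C * ((psi' (xs k))^*%C * (psi (xs k) - c * psi' (xs k))).
  rewrite /X rmorphB rmorph_sum /= mulrBr mulr_sumr /S addrAC -sumrB.
  congr (_ - _); last by rewrite mulrC.
  by apply: eq_bigr => k _; rewrite rmorphM /= sqmodJ; ring.
have : normc (c * X%:C) <= delta + kappa * \sum_k `|v (xs k) - v' (xs k)|.
  rewrite EX; apply: le_trans (normcD _ _) _; rewrite normcN; apply: lerD => //.
  apply: le_trans (normc_sum _ _ _) _; rewrite mulr_sumr; apply: ler_sum => k _.
  rewrite normcM normc_real mulrC ler_wpM2r // normcM normc_conj.
  rewrite -[X in _ <= X]mul1r; apply: ler_pM; rewrite ?normc_ge0 // normc_le1 //.
rewrite normcM normc_real => HX.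
have := normr_ge0 X; nra.
Qed.


(** * Clusters of potentials with energies in one cube of side [h] *)

Section Cell.
Variables (n : nat) (xs : 'I_n -> L) (I : finType) (A : {set I}).
Variables (v : I -> L -> R) (E : I -> 'I_n -> R) (psi : I -> 'I_n -> L -> C).
Variables (m : I -> 'cV[int]_n) (z b0 : 'I_n -> R) (h delta K eta eps kappa r : R).
Hypotheses (xs_inj : injective xs) (h0 : 0 < h) (delta0 : 0 < delta) (K0 : 0 < K)
  (eta0 : 0 < eta) (eps0 : 0 < eps) (kappa0 : 0 < kappa).
Hypothesis eigen : forall q j, q \in A ->
  normalized_eigenfunction T (v q) (E q j) (psi q j).
Hypothesis resolv : forall q j, q \in A -> resolvent_bound T (v q) (E q j) (psi q j) K.
Hypothesis off_sites : forall q q' y, q \in A -> q' \in A ->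
  (forall k, y != xs k) -> `|v q y - v q' y| <= delta.
Hypothesis energies : forall q j, q \in A -> z j <= E q j <= z j + h.
Hypothesis sites : forall q k, q \in A ->
  b0 k + delta * (m q k 0)%:~R <= v q (xs k) <= b0 k + delta * ((m q k 0)%:~R + 1).
Hypothesis m_inj : {in A &, injective m}.

Let prof q : 'M[R]_n := \matrix_(j, k) sqmod (psi q j (xs k)).
Let D q : R := \det (prof q).
Hypothesis D_ge : forall q, q \in A -> eta <= `|D q|.

Let F : R := n`!%:R.
Let nR : R := n%:R.
Let l : R := #|L|%:R.
(** Here [delta] is the mesh of the grid and [r] the radius of closeness at the sites; by [hr],
    close potentials have eigenfunctions within [kappa] of each other up to a scalar. [hk2] to [hk4]
    make [kappa] small against [eta] and [eps], and [hfar] is the diagonal dominance that limits the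
    number of clusters to n!. *)
Hypotheses (hk1 : l * kappa <= 3 / 4) (hk1' : kappa <= 1)
  (hk2 : 4 * nR ^+ 2 * F * kappa <= eta)
  (hk3 : 24 * nR ^+ 2 * F * kappa <= eps * eta)
  (hk4 : 3 * nR * F * kappa <= eps * eta)
  (hr : K * (r + h) <= kappa) (hr0 : 0 < r)
  (hfar : 2 * nR * F * h * (n`!.+1)%:R < eta * r)
  (hd1 : (nR + 4) * delta <= eps * h) (hd2 : delta <= h) (hd3 : delta <= r).

Let near q q' := [forall k, `|v q (xs k) - v q' (xs k)| <= r].

Lemma prof_le1 q j k : q \in A -> `|prof q j k| <= 1.
Proof.
move=> qA; rewrite mxE ger0_norm ?sqmod_ge0 //; apply: sqmod_le1.
by have [] := @eigen q j qA.
Qed.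

Lemma energy_diff q q' j : q \in A -> q' \in A -> `|E q j - E q' j| <= h.
Proof.
move=> qA qA'; have := @energies q j qA; have := @energies q' j qA'.
by rewrite ler_norml => /andP[? ?] /andP[? ?]; apply/andP; split; lra.
Qed.

Lemma near_close q q' j x : q \in A -> q' \in A -> near q q' ->
  normc (psi q j x - cip (psi q' j) (psi q j) * psi q' j x) <= kappa.
Proof.
move=> qA qA' /forallP nr; apply: le_trans hr.
apply: (close_eigvec (@eigen q j qA) (@eigen q' j qA') (@resolv q' j qA')); last first.
  exact: energy_diff.
move=> y; have [/existsP[k /eqP ->]|] := boolP [exists k, y == xs k]; first exact: nr.
rewrite negb_exists => /forallP hy; apply: le_trans hd3; exact: off_sites.
Qed.

Lemma near_det q q' : q \in A -> q' \in A -> near q q' -> `|D q| <= (1 + eps) * `|D q'|.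
Proof.
move=> qA qA' nr.
have l0 : 0 <= l by rewrite ler0n.
have : `|D q - D q'| <= F * (nR * (3 * kappa)).
  apply: det_lipschitz; [by move=> *; apply: prof_le1..|].
  move=> j k; rewrite !mxE.
  have [nq _] := @eigen q j qA; have [nq' _] := @eigen q' j qA'.
  apply: le_trans (close_sqmod nq nq' (fun x => near_close j x qA qA' nr) _ _) _.
    exact: ltW.
  have := ler_wpM2r (ltW kappa0) hk1; rewrite -/l expr2 mulrA => h1.
  by apply: le_trans (lerD (lexx _) h1) _; have := kappa0; lra.
have := D_ge qA'; have := ler_normD (D q - D q') (D q'); rewrite subrK => h1 h2 h3.
have : F * (nR * (3 * kappa)) <= eps * `|D q'|.
  apply: le_trans (_ : eps * eta <= _); last by rewrite ler_pM2l.
  by apply: le_trans hk4; rewrite le_eqVlt; apply/orP; left; apply/eqP; ring.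
by lra.
Qed.

(** The error in [linearized_energy] contains the displacement [s] itself. Cramer's rule bounds
    [eta * s] by a term of order [h] plus a multiple of [kappa * s], and [hk2] absorbs the
    latter. *)
Lemma near_linear q q' j : q \in A -> q' \in A -> near q q' ->
  `|\sum_k prof q' j k * (v q (xs k) - v q' (xs k)) - (E q j - E q' j)| <= eps * h.
Proof.
move=> qA qA' nr; set s := \sum_k `|v q (xs k) - v q' (xs k)|.
have lin i : `|\sum_k prof q' i k * (v q (xs k) - v q' (xs k)) - (E q i - E q' i)| <=
  2 * (delta + kappa * s).
  under eq_bigr do rewrite mxE.
  apply: linearized_energy => //; [exact: eigen | exact: eigen | exact: ltW | | exact: ltW | | ].
  - by move=> y hy; apply: off_sites.
  - have l0 : 0 <= l by rewrite ler0n.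
    rewrite -/l expr2 mulrA; apply: le_trans (_ : l * kappa * 1 <= _); last by rewrite mulr1.
    by rewrite ler_wpM2l // mulr_ge0 // ltW.
  - by move=> x; apply: near_close.
have n0 : 0 <= nR by rewrite ler0n.
have F0 : 0 <= F by rewrite ler0n.
have s0 : 0 <= s by apply: sumr_ge0.
have wk k : eta * `|v q (xs k) - v q' (xs k)| <= F * (nR * (h + 2 * (delta + kappa * s))).
  pose w : 'cV[R]_n := \col_k (v q (xs k) - v q' (xs k)).
  have := cramer_bound w k (fun i j => prof_le1 i j qA').
  rewrite [w k 0]mxE => H; apply: le_trans (_ : `|D q'| * `|v q (xs k) - v q' (xs k)| <= _).
    by rewrite ler_wpM2r // D_ge.
  apply: le_trans H _; rewrite ler_wpM2l //.
  apply: le_trans (_ : \sum_(j < n) (h + 2 * (delta + kappa * s)) <= _).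
    apply: ler_sum => i _; rewrite mxE; under eq_bigr do rewrite [w _ _]mxE.
    have h1 := lin i; have h2 := energy_diff i qA qA'.
    set S := \sum_k _ in h1 *.
    have := ler_normD (S - (E q i - E q' i)) (E q i - E q' i); rewrite subrK; lra.
  by rewrite sumr_const card_ord -[_ *+ n]mulr_natl.
have sb : eta * s <= nR * (F * (nR * (h + 2 * (delta + kappa * s)))).
  rewrite /s mulr_sumr; apply: le_trans (ler_sum _ (fun k _ => wk k)) _.
  by rewrite sumr_const card_ord -[_ *+ n]mulr_natl.
have sb2 : eta * s <= 6 * nR ^+ 2 * F * h.
  have := ler_wpM2r s0 hk2.
  have : nR ^+ 2 * F * delta <= nR ^+ 2 * F * h by rewrite ler_wpM2l // mulr_ge0 // exprn_ge0.
  move: sb; rewrite !mulrDr; set a := nR ^+ 2 * F * h; set b := nR ^+ 2 * F * delta.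
  have -> : nR * (F * (nR * h)) = a by rewrite /a; ring.
  have -> : nR * (F * (nR * (2 * delta))) = 2 * b by rewrite /b; ring.
  have -> : nR * (F * (nR * (2 * (kappa * s)))) = (4 * nR ^+ 2 * F * kappa * s) / 2 by field.
  have -> : 6 * nR ^+ 2 * F * h = 6 * a by rewrite /a; ring.
  lra.
have ks : kappa * s <= eps * h / 4.
  rewrite -(ler_pM2l eta0).
  have -> : eta * (kappa * s) = kappa * (eta * s) by ring.
  apply: le_trans (ler_wpM2l (ltW kappa0) sb2) _.
  have -> : kappa * (6 * nR ^+ 2 * F * h) = (24 * nR ^+ 2 * F * kappa) * (h / 4) by field.
  have -> : eta * (eps * h / 4) = eps * eta * (h / 4) by ring.
  by rewrite ler_wpM2r // divr_ge0 // ltW.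
apply: le_trans (lin j) _.
have : 4 * delta <= eps * h.
  by apply: le_trans hd1; apply: ler_wpM2r (ltW delta0) _ _ _; rewrite lerDr.
lra.
Qed.

(** By linearization [delta *: prof q'] maps the unit cubes at the points [m q] into one box, and
    [packing] bounds their number. A side of the box is [h] for the energies plus [2 * eps * h] at
    both ends: one [eps * h] for the linearization, one for the size of a cell. *)
Lemma near_sum q' : q' \in A ->
  \sum_(q in A | near q q') delta ^+ n * `|D q| <=
  (1 + eps) * ((1 + 4 * eps) * h) ^+ n.
Proof.
move=> qA'; pose N := [set q in A | near q q'].
have Dq0 : 0 < `|D q'| by apply: lt_le_trans (D_ge qA').
pose cst j := \sum_k prof q' j k * (v q' (xs k) - b0 k).
have pk : (size [seq m q | q <- enum N])%:R * `|\det (delta *: prof q')| <=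
   \prod_(j < n) ((1 + 4 * eps) * h).
  apply: (@packing _ _ _ _ (fun j => z j - E q' j + cst j - 2 * eps * h)).
  - rewrite map_inj_in_uniq ?enum_uniq // => q1 q2.
    by rewrite !mem_enum !inE => /andP[? _] /andP[? _]; apply: m_inj.
  - rewrite detZ mulf_neq0 ?expf_neq0 ?(lt0r_neq0 delta0) //.
    by rewrite -normr_gt0.
  - by move=> j; rewrite mulr_ge0 ?(ltW h0) // addr_ge0 // mulr_ge0 // ltW.
  move=> mq /mapP[q]; rewrite mem_enum inE => /andP[qA nr] -> u hu j.
  (* The offset of a point of the cell from the chosen potential in that cell. *)
  pose t k := delta * u k 0 + b0 k - v q (xs k).
  have tk k : `|t k| <= delta.
    have /andP[a1 a2] := @sites q k qA; have /andP[u1 u2] := hu k.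
    have := ler_wpM2l (ltW delta0) u1; have := ler_wpM2l (ltW delta0) u2.
    rewrite mulrDr mulr1 in a2 *; rewrite /t ler_norml => ? ?; apply/andP; split; lra.
  have -> : (delta *: prof q' *m u) j 0 =
     (\sum_k prof q' j k * (v q (xs k) - v q' (xs k)) - (E q j - E q' j)) +
     (E q j - E q' j) + cst j + \sum_k prof q' j k * t k.
    rewrite subrK /cst -!big_split mxE /=; apply: eq_bigr => k _.
    by rewrite /t [X in X * _ = _]mxE; ring.
  have := near_linear j qA qA' nr; set X := \sum_k _ * _ - _.
  have tS : `|\sum_k prof q' j k * t k| <= nR * delta.
    apply: le_trans (ler_norm_sum _ _ _) _.
    apply: le_trans (_ : \sum_(k < n) delta <= _).
      apply: ler_sum => k _; rewrite normrM -[X in _ <= X]mul1r.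
      by apply: ler_pM => //; apply: prof_le1.
    by rewrite sumr_const card_ord -[_ *+ n]mulr_natl.
  have nd : nR * delta <= eps * h.
    by apply: le_trans hd1; apply: ler_wpM2r (ltW delta0) _ _ _; rewrite lerDl.
  move: tS; set Y := \sum_k prof q' j k * t k.
  have /andP[e1 e2] := @energies q j qA.
  rewrite !ler_norml mulrDl mul1r => /andP[? ?] /andP[? ?].
  by apply/andP; split; lra.
rewrite size_map -cardE prodr_const card_ord detZ normrM normrX gtr0_norm // in pk.
apply: le_trans (_ : \sum_(q in N) delta ^+ n * ((1 + eps) * `|D q'|) <= _).
  rewrite [X in _ <= X](eq_bigl (fun q => (q \in A) && near q q')); last first.
    by move=> q; rewrite inE.
  apply: ler_sum => q /andP[qA nr]; rewrite ler_wpM2l ?exprn_ge0 ?(ltW delta0) //.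
  exact: near_det.
rewrite sumr_const -[_ *+ _]mulr_natl.
have -> : #|N|%:R * (delta ^+ n * ((1 + eps) * `|D q'|)) =
  (1 + eps) * (#|N|%:R * (delta ^+ n * `|D q'|)) by ring.
by rewrite ler_wpM2l // addr_ge0 // ltW.
Qed.

(** Cramer's rule for the complex matrix of the Green identity: it maps the displacement to a vector
    with entries at most [2 * h], while the displacement exceeds [r] at some site. *)
Lemma far_det q q' : q \in A -> q' \in A -> ~~ near q q' ->
  normc (\det (\matrix_(j < n, k < n) ((psi q' j (xs k))^*%C * psi q j (xs k)))) * r <=
  2 * nR * F * h.
Proof.
move=> qA qA'; rewrite negb_forall => /existsP[k]; rewrite -ltNge => hk.
set M := \matrix_(_, _) _.
pose w : 'cV[C]_n := \col_k (v q (xs k) - v q' (xs k))%:C.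
have M1 i j : `|M i j| <= 1.
  rewrite norm_normc mxE -[1]/(1%:C) lecR normcM normc_conj.
  rewrite -[X in _ <= X]mul1r; apply: ler_pM; rewrite ?normc_ge0 // normc_le1 //.
  - by have [] := @eigen q' i qA'.
  - by have [] := @eigen q i qA.
have := cramer_bound w k M1.
rewrite !norm_normc -rmorphM /=.
under eq_bigr do rewrite norm_normc.
rewrite -rmorph_sum -[n`!%:R](rmorph_nat (real_complex R)) -rmorphM lecR => H.
apply: le_trans (_ : normc (\det M) * normc (w k 0) <= _).
  rewrite ler_wpM2l ?normc_ge0 // mxE normc_real; exact: ltW.
apply: le_trans H _; rewrite -/F.
have -> : 2 * nR * F * h = F * (nR * (h + h)) by ring.
rewrite ler_wpM2l ?ler0n //.
apply: le_trans (_ : \sum_(j < n) (h + h) <= _); last first.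
  by rewrite sumr_const card_ord -[_ *+ n]mulr_natl.
apply: ler_sum => j _.
have := green_local hermT xs_inj (@eigen q j qA) (@eigen q' j qA') (ltW delta0)
  (fun y => @off_sites q q' y qA qA').
have [n1 _] := @eigen q j qA; have [n2 _] := @eigen q' j qA'.
set S := \sum_k _ * _ => HS.
have -> : (M *m w) j 0 = S.
  by rewrite mxE; apply: eq_bigr => i _; rewrite !mxE mulrC.
have := normcD (S - (E q j - E q' j)%:C * cip (psi q' j) (psi q j))
  ((E q j - E q' j)%:C * cip (psi q' j) (psi q j)).
rewrite subrK => /le_trans; apply; rewrite addrC; apply: lerD; last exact: le_trans hd2.
rewrite normcM normc_real -[X in _ <= X]mulr1; apply: ler_pM; rewrite ?normc_ge0 //.
  exact: energy_diff.
apply: le_trans (normc_prod_le n2 n1); exact: normc_sum.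
Qed.

(** A maximal set [S] of pairwise far indices has at most n! elements by [far_det] and
    [gram_card_le]; every index is near one of them, and [near_sum] applies. *)
Lemma cell_sum : \sum_(q in A) delta ^+ n * `|D q| <=
  F * ((1 + eps) * ((1 + 4 * eps) * h) ^+ n).
Proof.
have nrefl : reflexive near.
  by move=> q; apply/forallP => k; rewrite subrr normr0 ltW.
have nsym : symmetric near.
  by move=> q q'; apply/eq_forallb => k; rewrite distrC.
have [S SA [Scov Ssep]] := exists_separated A nrefl nsym.
have cardS : (#|S| <= n`!)%N.
  pose ev (s : 'I_#|S|) : I := @enum_val I (pred_of_set S) s.
  have evS s : ev s \in S by apply: (@enum_valP I (pred_of_set S)).
  pose U (s : 'I_#|S|) : 'M[C]_n := \matrix_(j, k) (psi (ev s) j (xs k))^*%C.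
  pose W (s : 'I_#|S|) : 'M[C]_n := \matrix_(j, k) psi (ev s) j (xs k).
  have inA s : ev s \in A by apply: (subsetP SA); exact: (evS s).
  have EM s t : \matrix_(j, k) (U s j k * W t j k) =
     \matrix_(j < n, k < n) ((psi (ev s) j (xs k))^*%C * psi (ev t) j (xs k)).
    by apply/matrixP => j k; rewrite !mxE.
  pose theta := 2 * nR * F * h / r.
  have th0 : 0 <= theta by rewrite divr_ge0 ?mulr_ge0 ?ler0n ?ltW.
  apply: (@gram_card_le _ _ _ U W (eta%:C) (theta%:C)).
  - by rewrite -[0]/(0%:C) lecR.
  - move=> s; rewrite EM norm_normc lecR.
    have -> : \matrix_(j < n, k < n) ((psi (ev s) j (xs k))^*%C * psi (ev s) j (xs k))
      = map_mx (real_complex R) (prof (ev s)).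
      by apply/matrixP => j k; rewrite !mxE -sqmodJ.
    by rewrite det_map_mx normc_real; apply: D_ge.
  - move=> s t st; rewrite EM norm_normc lecR ler_pdivlMr //.
    apply: far_det => //; apply: Ssep; rewrite ?evS //.
    by apply: contraNneq st => /enum_val_inj ->.
  - rewrite -[n`!.+1%:R](rmorph_nat (real_complex R)) -rmorphM ltcR.
    by rewrite /theta mulrA ltr_pdivrMr // mulrC.
apply: le_trans (_ : \sum_(q' in S) \sum_(q in A | near q q') delta ^+ n * `|D q| <= _).
  rewrite (exchange_big_dep (mem A)) /=; last by move=> ? ? _ /andP[].
  apply: ler_sum => q qA; have [q' q'S nr] := Scov q qA.
  rewrite (bigD1 q') /=; last by rewrite q'S qA.
  by rewrite lerDl sumr_ge0 // => ? _; rewrite mulr_ge0 ?exprn_ge0 // ltW.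
apply: le_trans (_ : \sum_(q' in S) ((1 + eps) * ((1 + 4 * eps) * h) ^+ n) <= _).
  by apply: ler_sum => q' q'S; apply: near_sum; apply: (subsetP SA).
rewrite sumr_const -[_ *+ _]mulr_natl; apply: ler_wpM2r; last by rewrite ler_nat.
by rewrite !(mulr_ge0, exprn_ge0, addr_ge0) // ltW.
Qed.

End Cell.
End Linearize.

From mathcomp Require Import all_classical all_reals all_analysis.
From mathcomp Require Import complex.
Import Order.TTheory GRing.Theory Num.Theory.
Local Open Scope classical_set_scope.
Local Open Scope ring_scope.

(** * Probabilities of grid cells *)

Section Grid.
Variables (R : realType) (L : finType) (d : measure_display) (Om : measurableType d).
Variables (P : probability Om R) (V : L -> Om -> R) (rho : R).
Hypothesis mV : forall x, measurable_fun setT (V x).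
Hypothesis cond : conditional_density_bounded P V rho.

(* The conditional density is not jointly measurable, which rules out
   [ge0_le_integral]; the integral of a nonnegative function is however a
   supremum over the simple functions below it. *)
Lemma le_integral_ge0 d' (T' : measurableType d') (mu : {measure set T' -> \bar R})
  (D : set T') (f g : T' -> \bar R) :
  (forall x, D x -> 0 <= f x)%E -> (forall x, D x -> f x <= g x)%E ->
  (\int[mu]_(x in D) f x <= \int[mu]_(x in D) g x)%E.
Proof.
move=> f0 fg; rewrite !ge0_integralE //; last first.
  by move=> x Dx; apply: le_trans (fg x Dx); apply: f0.
apply: le_ereal_sup => _ [k /= Hk <-]; exists k => // x.
apply: le_trans (Hk x) _; rewrite /patch; case: ifPn => // xD.
by apply: fg; rewrite -in_setE.
Qed.

Lemma rho_ge0 (x : L) : 0 <= rho.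
Proof.
have [f [_ [fb _]]] := cond x.
have [w _] : exists w : Om, True.
  have /set0P[w _] : [set: Om] != set0; last by exists w.
  by apply/eqP => E; have := probability_setT P; rewrite E measure0 => /eqP; rewrite eqe eq_sym oner_eq0.
by have /andP[] := fb w 0; apply: le_trans.
Qed.

Lemma cond_prob_le (x : L) (A : set R) (C : set Om) :
  measurable A -> measurable C -> sigma_others V x C ->
  (P (C `&` V x @^-1` A) <= rho%:E * lebesgue_measure A * P C)%E.
Proof.
move=> mA mC sC; have [f [mf [fb [_ ->]]]] := cond x => //.
have r0 := rho_ge0 x.
apply: (@le_trans _ _ (\int[P]_(w in C) cst (rho%:E * lebesgue_measure A)%E w)%E).
  apply: le_integral_ge0 => w _.
    by apply: integral_ge0 => t _; rewrite lee_fin; case/andP: (fb w t).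
  rewrite /cst -integral_cst //; apply: le_integral_ge0 => t _.
    by rewrite lee_fin; case/andP: (fb w t).
  by rewrite lee_fin; case/andP: (fb w t).
by rewrite integral_cst.
Qed.

Variables (b0 : R) (K : nat).
Variable delta : R.
Hypothesis delta0 : 0 < delta.

(** Half-open, so that distinct grid cells are disjoint. *)
Definition slot (i : nat) : set R := `[b0 + delta * i%:R, b0 + delta * i.+1%:R[.

(** The full set [S] gives a cube of the grid, a smaller one the cylinder over a projection of that
    cube. *)
Definition cell (S : {set L}) (q : {ffun L -> 'I_K}) : set Om :=
  [set w | forall x, x \in S -> slot (q x) (V x w)].

Lemma cellE S q : cell S q = \bigcap_(x in [set` S]) (V x @^-1` slot (q x)).
Proof. by []. Qed.

Lemma measurable_slot i : measurable (slot i).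
Proof. exact: measurable_itv. Qed.

Lemma lebesgue_slot i : lebesgue_measure (slot i) = delta%:E.
Proof.
rewrite /slot lebesgue_measure_itv /= lte_fin ltrD2l ltr_pM2l // ltr_nat ltnSn.
by rewrite -EFinD -natr1; congr EFin; ring.
Qed.

Lemma measurable_cell S q : measurable (cell S q).
Proof.
rewrite cellE; apply: fin_bigcap_measurable; first exact: finite_finset.
by move=> x _; rewrite -[X in measurable X]setTI; apply: mV => //; apply: measurable_slot.
Qed.

Lemma sigma_others_cell (S : {set L}) q x : x \notin S -> sigma_others V x (cell S q).
Proof.
move=> xS; rewrite cellE.
pose G := [set S | exists y, y <> x /\ exists B : set R, measurable B /\ S = V y @^-1` B].
apply: (@fin_bigcap_measurable _ (g_sigma_algebraType G)); first exact: finite_finset.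
move=> y /= yS; apply: sub_sigma_algebra; exists y; split.
  by move=> E; move: xS; rewrite -E yS.
by exists (slot (q y)); split=> //; apply: measurable_slot.
Qed.

Definition mass S q : R := fine (P (cell S q)).

Lemma massE S q : P (cell S q) = (mass S q)%:E.
Proof. by rewrite fineK // fin_num_measure //; apply: measurable_cell. Qed.

Lemma mass_ge0 S q : 0 <= mass S q.
Proof. exact: fine_ge0. Qed.

Lemma mass_step (S : {set L}) q x : x \notin S -> mass (x |: S) q <= rho * delta * mass S q.
Proof.
move=> xS; rewrite -lee_fin !EFinM -!massE -(lebesgue_slot (q x)).
have -> : cell (x |: S) q = cell S q `&` V x @^-1` slot (q x).
  apply/seteqP; split => w /=.
    by move=> h; split; [move=> y yS|]; apply: h; rewrite !inE ?yS ?orbT ?eqxx.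
  by move=> [h1 h2] y; rewrite !inE => /orP[/eqP->|/h1].
apply: cond_prob_le; [exact: measurable_slot|exact: measurable_cell|].
exact: sigma_others_cell.
Qed.

Lemma mass_imset n (xs : 'I_n -> L) q : injective xs ->
  mass [set: L]%SET q <= (rho * delta) ^+ n * mass (~: (xs @: 'I_n))%SET q.
Proof.
move=> inj; pose S0 : {set L} := (~: (xs @: 'I_n))%SET.
suff H (s : seq 'I_n) : uniq s ->
    mass (S0 :|: [set xs i | i in s])%SET q <= (rho * delta) ^+ size s * mass S0 q.
  have := H (enum 'I_n) (enum_uniq _); rewrite size_enum_ord.
  suff -> : (S0 :|: [set xs i | i in enum 'I_n])%SET = [set: L]%SET by [].
  apply/setP => x; rewrite !inE orbC; apply/orP.
  have [/imsetP[i _ ->]|] := boolP (x \in xs @: 'I_n); last by right.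
  by left; apply: imset_f; rewrite mem_enum.
elim: s => [_|i s IH /= /andP[iNs us]].
  rewrite expr0 mul1r; suff -> : (S0 :|: [set xs i | i in [::]])%SET = S0 by [].
  apply/setP => x; rewrite !inE; apply/orP/idP; last by left.
  by case=> // /imsetP[j]; rewrite inE.
have -> : (S0 :|: [set xs j | j in i :: s])%SET = (xs i |: (S0 :|: [set xs j | j in s]))%SET.
  apply/setP => x; rewrite !inE orbCA; congr (_ || _).
  apply/imsetP/orP.
    move=> [j]; rewrite inE => /orP[/eqP-> ->|js ->]; first by left.
    by right; apply: imset_f.
  case=> [/eqP->|/imsetP[j js ->]]; first by exists i; rewrite ?inE ?eqxx.
  by exists j; rewrite ?inE ?js ?orbT.
have r0 := rho_ge0 (xs i).
apply: le_trans (mass_step _ _) _.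
  rewrite !inE negb_or negbK imset_f //=; apply/imsetP => -[j js /inj ij].
  by move: iNs; rewrite ij js.
by rewrite exprS -[X in _ <= X]mulrA ler_wpM2l ?IH // mulr_ge0 // ltW.
Qed.

Lemma sum_mass_le1 (S : {set L}) (U : {set {ffun L -> 'I_K}}) :
  (forall u u', u \in U -> u' \in U -> u != u' -> exists2 x, x \in S & u x != u' x) ->
  \sum_(u in U) mass S u <= 1.
Proof.
move=> HU.
have H (s : seq {ffun L -> 'I_K}) : uniq s -> {subset s <= U} ->
   (P (\big[setU/set0]_(u <- s) cell S u) = \sum_(u <- s) P (cell S u))%E.
  elim: s => [_ _|u s IH /= /andP[us uqs] sU]; first by rewrite !big_nil measure0.
  rewrite !big_cons -(IH uqs); last by move=> v vs; apply: sU; rewrite inE vs orbT.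
  rewrite measureU //.
  - exact: measurable_cell.
  - by apply: bigsetU_measurable => v _; apply: measurable_cell.
  - apply/seteqP; split => // w [wu].
    rewrite -bigcup_seq => -[v vs wv].
    have uU : u \in U by apply: sU; rewrite inE eqxx.
    have vU : v \in U by apply: sU; rewrite inE vs orbT.
    have uv : u != v by apply: contraNneq us => ->.
    have [x xS] := HU u v uU vU uv.
    move=> /negP[]; apply/eqP/val_inj; move: (wu x xS) (wv x xS).
    rewrite /slot /= !in_itv /= => /andP[a1 a2] /andP[b1 b2].
    have l1 : b0 + delta * (u x)%:R < b0 + delta * (v x).+1%:R by apply: le_lt_trans a1 _.
    have l2 : b0 + delta * (v x)%:R < b0 + delta * (u x).+1%:R by apply: le_lt_trans b1 _.
    rewrite ltrD2l ltr_pM2l // ltr_nat ltnS in l1.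
    rewrite ltrD2l ltr_pM2l // ltr_nat ltnS in l2.
    by apply/eqP; rewrite eqn_leq l1.
have := H (enum U) (enum_uniq _) (fun u h => etrans (esym (mem_enum _ _)) h).
rewrite -lee_fin -sumEFin -big_enum /=.
under [X in _ -> (X <= _)%E]eq_bigr do rewrite -massE.
move=> <-; apply: probability_le1.
by apply: bigsetU_measurable => v _; apply: measurable_cell.
Qed.

(* Integrating out the coordinates [xs k] one at a time costs a factor [rho] each. *)
Lemma sum_mass_le n (xs : 'I_n -> L) (g : {ffun L -> 'I_K} -> R) (G : R) :
  injective xs -> 0 <= G -> (0 < n)%N -> (forall q, 0 <= g q) ->
  (forall u : {ffun L -> 'I_K},
     \sum_(q : {ffun L -> 'I_K} | [forall y, (y \notin xs @: 'I_n) ==> (q y == u y)]) delta ^+ n * g q <= G) ->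
  \sum_q mass [set: L]%SET q * g q <= rho ^+ n * G.
Proof.
move=> inj G0 n0 g0 HG.
have r0 : 0 <= rho by apply: rho_ge0 (xs (Ordinal n0)).
pose S0 : {set L} := (~: (xs @: 'I_n))%SET.
(* If there is no index [q] at all, the sum is empty. *)
case: (pickP (fun q : {ffun L -> 'I_K} => true)) => [q0 _|E0]; last first.
  rewrite big1 ?mulr_ge0 ?exprn_ge0 // => q _; by have := E0 q.
(* Overwriting the coordinates at the sites by those of the fixed [q0] gives a canonical label for
   the projection of the cell. *)
pose res (q : {ffun L -> 'I_K}) : {ffun L -> 'I_K} :=
  [ffun x => if x \in xs @: 'I_n then q0 x else q x].
pose U := [set res q | q : {ffun L -> 'I_K}]%SET.
have massres q : mass S0 q = mass S0 (res q).
  congr (fine (P _)); apply/seteqP; split => w H x xS; have := H x xS; rewrite !ffunE;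
    by move: xS; rewrite inE => /negbTE ->.
rewrite (partition_big res (mem U)) /=; last by move=> q _; apply: imset_f.
apply: (@le_trans _ _ (\sum_(u in U) mass S0 u * (rho ^+ n * G))).
  apply: ler_sum => u uU.
  apply: (@le_trans _ _ (\sum_(q | res q == u) mass S0 u * (rho ^+ n * (delta ^+ n * g q)))).
    apply: ler_sum => q /eqP <-; rewrite -massres.
    apply: le_trans (ler_wpM2r (g0 q) (mass_imset q inj)) _.
    by rewrite exprMn le_eqVlt; apply/orP; left; apply/eqP; ring.
  rewrite -mulr_sumr; apply: ler_wpM2l; first exact: mass_ge0.
  rewrite -mulr_sumr; apply: ler_wpM2l; first exact: exprn_ge0.
  apply: le_trans (HG u); rewrite le_eqVlt; apply/orP; left; apply/eqP; apply: eq_bigl => q.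
  case/imsetP: uU => q' _ ->; apply/eqP/forallP => [E y|H].
    by apply/implyP => hy; rewrite -E ffunE (negbTE hy).
  apply/ffunP => y; have := H y; rewrite !ffunE; case: ifP => //= _ /eqP ->.
  by [].
rewrite -mulr_suml -[X in _ <= X]mul1r; apply: ler_wpM2r.
  by rewrite mulr_ge0 ?exprn_ge0.
apply: sum_mass_le1 => _ _ /imsetP[q _ ->] /imsetP[q' _ ->] ne.
apply/exists_inP; rewrite -[X in is_true X]negbK negb_exists_in; apply: contra ne => /forall_inP H.
apply/eqP/ffunP => y; have [yx|yx] := boolP (y \in xs @: 'I_n).
  by rewrite !ffunE yx.
by apply/eqP; rewrite -[_ == _]negbK; apply: H; rewrite inE.
Qed.

End Grid.

(** * Summing profile determinants over grid cells *)

Definition profile_det (R : realType) (L : finType) n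
    (psi : 'I_n -> L -> complex R) (xs : 'I_n -> L) : R :=
  \det (\matrix_(j < n, k < n) sqmod (psi j (xs k))).

Section Constants.
Variables (R : realType) (L : finType) (T : L -> L -> complex R).
Hypothesis hermT : hermitian_kernel T.

(** The constants [kappa], [r], [h1] are fixed in this order from [K], [eta] and [eps], so the
    threshold [h1] is uniform in the sites, the grid and the potentials. *)
Lemma cell_sum_bound n (K eta eps : R) : 0 < K -> 0 < eta -> 0 < eps ->
  exists2 h1, 0 < h1 & forall h delta, 0 < h <= h1 -> 0 < delta -> delta <= h ->
    (n%:R + 4) * delta <= eps * h ->
  forall (xs : 'I_n -> L) (I : finType) (A : {set I})
    (v : I -> L -> R) (E : I -> 'I_n -> R) (psi : I -> 'I_n -> L -> complex R)
    (m : I -> 'cV[int]_n) (z b0 : 'I_n -> R),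
  injective xs ->
  (forall q j, q \in A -> normalized_eigenfunction T (v q) (E q j) (psi q j)) ->
  (forall q j, q \in A -> resolvent_bound T (v q) (E q j) (psi q j) K) ->
  (forall q q' y, q \in A -> q' \in A ->
     (forall k, y != xs k) -> `|v q y - v q' y| <= delta) ->
  (forall q j, q \in A -> z j <= E q j <= z j + h) ->
  (forall q k, q \in A ->
     b0 k + delta * (m q k 0)%:~R <= v q (xs k) <= b0 k + delta * ((m q k 0)%:~R + 1)) ->
  {in A &, injective m} ->
  (forall q, q \in A -> eta <= `|\det (\matrix_(j < n, k < n) sqmod (psi q j (xs k)))|) ->
  \sum_(q in A) delta ^+ n * `|\det (\matrix_(j < n, k < n) sqmod (psi q j (xs k)))| <=
  n`!%:R * ((1 + eps) * ((1 + 4 * eps) * h) ^+ n).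
Proof.
move=> K0 eta0 eps0.
pose F : R := n`!%:R; pose N : R := n%:R; pose l : R := #|L|%:R.
have F0 : 0 <= F by rewrite ler0n.
have N0 : 0 <= N by rewrite ler0n.
have l0 : 0 <= l by rewrite ler0n.
have ee : 0 < eps * eta by rewrite mulr_gt0.
have aux (c b : R) : 0 <= c -> 0 < b -> exists2 k, 0 < k & forall k', 0 < k' <= k -> c * k' <= b.
  move=> c0 b1; exists (b / (c + 1)); first by rewrite divr_gt0 // ltr_wpDl.
  move=> k' /andP[k0]; rewrite ler_pdivlMr ?ltr_wpDl // => h.
  by apply: le_trans h; rewrite mulrC ler_pM2l // lerDl.
have [k1 k10 H1] := aux l (3 / 4) l0 ltac:(lra).
have [k2 k20 H2] := aux (4 * N ^+ 2 * F) eta ltac:(by rewrite !mulr_ge0 ?exprn_ge0) eta0.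
have [k3 k30 H3] := aux (24 * N ^+ 2 * F) _ ltac:(by rewrite !mulr_ge0 ?exprn_ge0) ee.
have [k4 k40 H4] := aux (3 * N * F) _ ltac:(by rewrite !mulr_ge0 ?exprn_ge0) ee.
pose kappa := Num.min (Num.min 1 k1) (Num.min k2 (Num.min k3 k4)).
have kappa0 : 0 < kappa by rewrite !lt_min ltr01 k10 k20 k30 k40.
have : kappa <= kappa by [].
rewrite {2}/kappa !le_min => /andP[/andP[kle1 kle1'] /and3P[kle2 kle3 kle4]].
(* Half of [kappa / K], because [h] takes up at most another [r] in [K * (r + h) <= kappa]. *)
pose r := kappa / (2 * K).
have r0 : 0 < r by rewrite divr_gt0 ?mulr_gt0.
have er : 0 < eta * r / 2 by have := mulr_gt0 eta0 r0; lra.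
have [h2 h20 H5] := aux (2 * N * F * n`!.+1%:R) _ ltac:(by rewrite !mulr_ge0 ?ler0n) er.
exists (Num.min r h2); first by rewrite lt_min r0 h20.
move=> h delta /andP[h0]; rewrite le_min => /andP[hr hh2] d0 dh de.
move=> xs I A v E psi m z b0 inj eig res off en si minj Dge.
apply: (@cell_sum R L T hermT n xs I A v E psi m z b0 h delta K eta eps kappa r) => //.
- by apply: H1; rewrite kappa0.
- by apply: H2; rewrite kappa0.
- by apply: H3; rewrite kappa0.
- by apply: H4; rewrite kappa0.
- apply: (@le_trans _ _ (K * (r + r))); first by rewrite ler_pM2l // lerD2l.
  by rewrite /r le_eqVlt; apply/orP; left; apply/eqP; field; rewrite gt_eqF.
- have := H5 h; rewrite h0 hh2 => /(_ isT) h5.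
  rewrite mulrAC; apply: le_lt_trans h5 _; have := mulr_gt0 eta0 r0; lra.
- exact: le_trans hr.
Qed.
End Constants.

Section ProfileSum.
Variables (R : realType) (L : finType) (d : measure_display) (Om : measurableType d).
Variables (P : probability Om R) (V : L -> Om -> R) (rho : R) (T : L -> L -> complex R).
Hypothesis mV : forall x, measurable_fun setT (V x).
Hypothesis cond : conditional_density_bounded P V rho.
Hypothesis hermT : hermitian_kernel T.

Lemma card_ltn_ord (s M : nat) : (s <= M)%N -> #|[pred i : 'I_M | (i < s)%N]| = s.
Proof.
move=> sM; rewrite -sum1_card -(big_ord_widen _ (fun=> 1%N)) // sum1_card card_ord //.
Qed.

Lemma card_familyE (n : nat) (U : finType) (F : 'I_n -> pred U) :
  #|family F| = (\prod_(j < n) #|F j|)%N.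
Proof. by rewrite card_family foldrE big_map big_enum. Qed.

(** With the coordinates off the sites frozen, cells are sorted by the energy cube they hit, one
    cube for each choice of points in the lists [Z j]. [cell_sum_bound] handles one cube and
    [sum_mass_le] integrates out the sites. *)
Lemma sum_profile_bound n (K eta eps : R) : (0 < n)%N -> 0 < K -> 0 < eta -> 0 < eps ->
  exists2 h1, 0 < h1 & forall h delta, 0 < h <= h1 -> 0 < delta -> delta <= h ->
    (n%:R + 4) * delta <= eps * h ->
  forall (xs : 'I_n -> L) (b0 : R) (M : nat) (Z : 'I_n -> seq R)
    (bad : pred {ffun L -> 'I_M}) (v : {ffun L -> 'I_M} -> L -> R)
    (E : {ffun L -> 'I_M} -> 'I_n -> R) (psi : {ffun L -> 'I_M} -> 'I_n -> L -> complex R),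
  (forall q j, bad q -> normalized_eigenfunction T (v q) (E q j) (psi q j)) ->
  (forall q j, bad q -> resolvent_bound T (v q) (E q j) (psi q j) K) ->
  (forall q x, bad q -> slot b0 delta (q x) (v q x)) ->
  (forall q j, bad q -> exists2 z, z \in Z j & z <= E q j <= z + h) ->
  \sum_(q | bad q && (eta <= `|profile_det (psi q) xs|))
    mass P V b0 delta [set: L]%SET q * `|profile_det (psi q) xs| <=
  rho ^+ n * ((\prod_j (size (Z j))%:R) *
     (n`!%:R * ((1 + eps) * ((1 + 4 * eps) * h) ^+ n))).
Proof.
move=> n0 K0 eta0 eps0.
have [h1 h10 H1] := cell_sum_bound hermT n K0 eta0 eps0.
exists h1 => // h delta hh d0 dh de xs b0 M Z bad v E psi eig res slt HZ.
pose D q := profile_det (psi q) xs.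
have h_ge0 : 0 <= h by case/andP: hh => /ltW.
set G := n`!%:R * _.
have G0 : 0 <= G.
  by rewrite /G !mulr_ge0 ?exprn_ge0 ?mulr_ge0 ?addr_ge0 ?mulr_ge0 // ltW.
have ZG0 : 0 <= (\prod_j (size (Z j))%:R) * G by rewrite mulr_ge0 ?prodr_ge0.
(* A repeated site gives two equal columns, so no determinant reaches [eta]. *)
have [inj|ninj] := pselect (injective xs); last first.
  rewrite [X in X <= _]big_pred0; last first.
    move=> q; apply/negbTE/negP => /andP [_].
    suff -> : profile_det (psi q) xs = 0 by rewrite normr0 leNgt eta0.
    have /existsNP[i /existsNP[k /not_implyP[xik ik]]] := ninj.
    rewrite /profile_det -det_tr; apply: (@determinant_alternate _ _ _ i k); first exact/eqP.
    by move=> j; rewrite !mxE xik.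
  by rewrite mulr_ge0 ?exprn_ge0 //; apply: rho_ge0 cond (xs (Ordinal n0)).
pose g (q : {ffun L -> 'I_M}) : R := if bad q && (eta <= `|D q|) then `|D q| else 0.
have -> : \sum_(q | bad q && (eta <= `|profile_det (psi q) xs|))
     mass P V b0 delta [set: L]%SET q * `|profile_det (psi q) xs| =
   \sum_q mass P V b0 delta [set: L]%SET q * g q.
  by rewrite big_mkcond; apply: eq_bigr => q _; rewrite /g; case: ifP; rewrite ?mulr0.
apply: (sum_mass_le mV cond b0 d0 inj) => //; first by move=> q; rewrite /g; case: ifP.
move=> u; pose agree (q : {ffun L -> 'I_M}) := [forall y, (y \notin xs @: 'I_n) ==> (q y == u y)].
pose MZ := (\max_j size (Z j)).+1.
pose tt (q : {ffun L -> 'I_M}) : {ffun 'I_n -> 'I_MZ} :=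
  [ffun j => inord (find (fun z => z <= E q j <= z + h) (Z j))].
pose Fam := fun j : 'I_n => [pred i : 'I_MZ | (i < size (Z j))%N].
have sZ j : (size (Z j) <= \max_j size (Z j))%N by apply: leq_bigmax.
have has_find q j : bad q -> has (fun z => z <= E q j <= z + h) (Z j).
  by move=> bq; have [z zZ hz] := HZ q j bq; apply/hasP; exists z.
have ttE q j : bad q -> tt q j = find (fun z => z <= E q j <= z + h) (Z j) :> nat.
  move=> bq; rewrite ffunE inordK // ltnS; apply: leq_trans (sZ j).
  by apply: ltnW; rewrite -seq.has_find; apply: has_find.
apply: (@le_trans _ _
    (\sum_(q | agree q && (bad q && (eta <= `|D q|))) delta ^+ n * `|D q|)).
  rewrite [X in _ <= X]big_mkcondr; apply: ler_sum => q _.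
  by rewrite /g; case: ifP; rewrite ?mulr0.
rewrite (partition_big tt (mem (family Fam))) /=; last first.
  move=> q /and3P [_ bq _]; apply/familyP => j.
  by rewrite inE /= ttE // -seq.has_find has_find.
apply: (@le_trans _ _ (\sum_(t in family Fam) G)); last first.
  rewrite sumr_const card_familyE -[_ *+ _]mulr_natl natr_prod.
  rewrite le_eqVlt; apply/orP; left; apply/eqP; congr (_ * _); apply: eq_bigr => j _.
  by rewrite card_ltn_ord // ltnW // ltnS.
apply: ler_sum => t tF.
pose A := [set q | (agree q && (bad q && (eta <= `|D q|))) && (tt q == t)]%SET.
have -> : \sum_(q | (agree q && (bad q && (eta <= `|D q|))) && (tt q == t)) delta ^+ n * `|D q|
  = \sum_(q in A) delta ^+ n * `|D q| by apply: eq_bigl => q; rewrite inE.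
have Ab q : q \in A -> bad q by rewrite inE => /andP[/and3P[]].
have Aag q y : q \in A -> (forall k, y != xs k) -> q y = u y.
  rewrite inE => /andP[/andP[/forallP ag _] _] hy; apply/eqP; move: (ag y) => /implyP; apply.
  by apply/imsetP => -[k _]; apply/eqP.
apply: (H1 h delta hh d0 dh de xs _ A v E psi
  (fun q => \col_k (q (xs k) : nat)%:Z) (fun j => nth 0 (Z j) (t j)) (fun=> b0)) => //.
- by move=> q j /Ab bq; apply: eig.
- by move=> q j /Ab bq; apply: res.
- move=> q q' y qA q'A hy; have := slt q y (Ab _ qA); have := slt q' y (Ab _ q'A).
  rewrite (Aag q y qA hy) (Aag q' y q'A hy) /slot /= !in_itv /= -natr1 mulrDr mulr1.
  by move=> /andP[? ?] /andP[? ?]; rewrite ler_norml; apply/andP; split; lra.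
- move=> q j qA; have bq := Ab q qA.
  move: qA; rewrite inE => /andP [_ /eqP <-].
  by rewrite ttE //; have := nth_find 0 (has_find q j bq).
- move=> q k /Ab bq; rewrite mxE; have := slt q (xs k) bq; rewrite /slot /= in_itv /=.
  by rewrite -natr1 => /andP[-> /ltW ->].
- move=> q q' qA q'A /matrixP E'; apply/ffunP => y.
  have [/existsP[k /eqP ->]|] := boolP [exists k, y == xs k].
    by apply/val_inj; have := E' k 0; rewrite !mxE => -[].
  by rewrite negb_exists => /forallP hy; rewrite (Aag q y) // (Aag q' y).
- by move=> q; rewrite inE => /andP[/and3P[]].
Qed.

End ProfileSum.

(** * Outer bounds and the regular part of the event *)

Section Outer.
Variables (R : realType) (d : measure_display) (Om : measurableType d).
Variable (P : probability Om R).

(** Bounds go through measurable supersets, since the events quantify over eigenfunctions and are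
    not shown to be measurable. *)
Definition outer_le (S : set Om) (c : \bar R) :=
  exists A : set Om, measurable A /\ S `<=` A /\ (P A <= c)%E.

Lemma outer_le_lim (S : set Om) (c : \bar R) :
  (forall e : R, 0 < e -> outer_le S (c + e%:E)%E) -> outer_le S c.
Proof.
move=> H.
have /choice[A HA] : forall k : nat, exists A : set Om,
    measurable A /\ S `<=` A /\ (P A <= c + (k.+1%:R^-1)%:E)%E.
  by move=> k; apply: H; rewrite invr_gt0 ltr0n.
exists (\bigcap_k A k); split; [|split].
- by apply: bigcapT_measurable => k; have [] := HA k.
- by move=> w Sw k _; have [_ [SA _]] := HA k; apply: SA.
apply/lee_addgt0Pr => e e0.
pose k := Num.truncn e^-1.
have [mA [_ PA]] := HA k.
apply: (@le_trans _ _ (P (A k))).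
  apply: le_measure; rewrite ?inE //; last by move=> w; apply.
  by apply: bigcapT_measurable => i; have [] := HA i.
apply: le_trans PA _; rewrite leeD2l // lee_fin -[leRHS]invrK lef_pV2 ?posrE ?invr_gt0 ?ltr0n //.
by apply: ltW; rewrite -truncn_lt_nat ?invr_ge0 ?ltW // ltnS.
Qed.

(** Continuity from below. The covers [A k] need not increase, but the intersections [B k] of their
    tails do, and these still contain [S k]. *)
Lemma outer_le_bigcup (S : nat -> set Om) (c : \bar R) :
  (forall i j, (i <= j)%N -> S i `<=` S j) ->
  (forall k, outer_le (S k) c) -> outer_le (\bigcup_k S k) c.
Proof.
move=> Smon /choice[A HA].
have mA k : measurable (A k) by have [] := HA k.
pose B k := \bigcap_(j in [set j | (k <= j)%N]) A j.
have mB k : measurable (B k) by apply: bigcap_measurable => [|j _]; [exists k => /=|apply: mA].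
exists (\bigcup_k B k); split; [|split].
- exact: bigcupT_measurable.
- move=> w [k _ Sw]; exists k => // j /= kj; have [_ [SA _]] := HA j.
  by apply: SA; apply: Smon Sw.
have mU : measurable (\bigcup_k B k) by apply: bigcupT_measurable.
have ndB : {homo B : n m / (n <= m)%N >-> (n <= m)%O}.
  move=> n m nm; apply/subsetPset => w Bw j /= mj; apply: Bw => /=; exact: leq_trans mj.
have cv := nondecreasing_cvg_mu (mu := P) mB mU ndB.
rewrite -(cvg_lim _ cv) //; apply: lime_le; first by apply/cvg_ex; eexists; exact: cv.
apply: nearW => k /=; have [_ [_ PA]] := HA k; apply: le_trans PA.
apply: le_measure; rewrite ?inE //.
by move=> w; apply => /=.
Qed.

Lemma outer_leU (S S' : set Om) (c : \bar R) :
  outer_le S c -> outer_le S' 0 -> outer_le (S `|` S') c.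
Proof.
move=> [A [mA [SA PA]]] [A' [mA' [SA' PA']]]; exists (A `|` A'); split; [|split].
- exact: measurableU.
- by move=> w [/SA|/SA']; [left|right].
apply: le_trans (measureU2 P mA mA') _.
by rewrite -[leRHS]adde0; apply: leeD.
Qed.

Lemma outer_leS (S S' : set Om) (c : \bar R) : S `<=` S' -> outer_le S' c -> outer_le S c.
Proof. by move=> SS [A [mA [SA PA]]]; exists A; split=> //; split=> // w /SS/SA. Qed.

Variables (L : finType) (V : L -> Om -> R).
Hypothesis mV : forall x, measurable_fun setT (V x).

(** The cover is the union of the grid cells that contain a good potential. *)
Lemma grid_cover (good : (L -> R) -> Prop) (b : R) (M : nat) : 0 < b ->
  (forall v, good v -> forall x, - b <= v x < b) ->
  let delta := 2 * b / M.+1%:R in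
  exists A : set Om, [/\ measurable A, [set w | good (fun x => V x w)] `<=` A &
    fine (P A) <= \sum_(q : {ffun L -> 'I_M.+1} |
        `[< exists2 v, good v & forall x, slot (- b) delta (q x) (v x) >])
      mass P V (- b) delta [set: L]%SET q].
Proof.
move=> b0 Hb; set delta : R := 2 * b / M.+1%:R => /=.
have M0 : 0 < M.+1%:R :> R by rewrite ltr0n.
have d0 : 0 < delta by rewrite divr_gt0 ?mulr_gt0.
pose bad (q : {ffun L -> 'I_M.+1}) :=
  `[< exists2 v, good v & forall x, slot (- b) delta (q x) (v x) >].
have mC := measurable_cell mV (- b) delta.
exists (\big[setU/set0]_(q | bad q) cell V (- b) delta [set: L]%SET q); split.
- by apply: bigsetU_measurable => q _; apply: mC.
- move=> w /= gw.
  pose f x := Num.truncn ((V x w + b) / delta).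
  have Hf x : (f x < M.+1)%N /\ slot (- b) delta (f x) (V x w).
    have /andP[h1 h2] := Hb _ gw x.
    have p0 : 0 <= (V x w + b) / delta by rewrite divr_ge0 ?(ltW d0) //; lra.
    split.
      rewrite truncn_lt_nat // ltr_pdivrMr // /delta mulrCA mulfV ?gt_eqF // mulr1; lra.
    have /andP[t1 t2] := truncn_itv p0.
    rewrite ler_pdivlMr // in t1; rewrite ltr_pdivrMr // in t2.
    rewrite /slot /= in_itv /= -/(f x) in t1 t2 *.
    by apply/andP; split; rewrite mulrC; lra.
  pose q : {ffun L -> 'I_M.+1} := [ffun x => inord (f x)].
  have qE x : q x = f x :> nat by rewrite ffunE inordK //; case: (Hf x).
  have bq : bad q.
    by apply/asboolP; exists (fun x => V x w) => // x; rewrite qE; case: (Hf x).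
  rewrite (bigD1 q) //=; left => x _; rewrite qE; by case: (Hf x).
- have sub (s : seq {ffun L -> 'I_M.+1}) :
    (P (\big[setU/set0]_(q <- s | bad q) cell V (- b) delta [set: L]%SET q) <=
     (\sum_(q <- s | bad q) mass P V (- b) delta [set: L]%SET q)%:E)%E.
    elim: s => [|q s IH]; first by rewrite !big_nil measure0.
    rewrite !big_cons; case: ifP => // _.
    apply: le_trans (measureU2 P _ _) _; first exact: mC.
      by apply: bigsetU_measurable => q' _; apply: mC.
    by rewrite EFinD; apply: leeD => //; rewrite -massE.
  rewrite -lee_fin fineK; first exact: sub.
  by rewrite fin_num_measure //; apply: bigsetU_measurable => q _; apply: mC.
Qed.

End Outer.

(** * Simple energies in sets covered by few short intervals *)

Section Core.
Variables (R : realType) (L : finType) (d : measure_display) (Om : measurableType d).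
Variables (P : probability Om R) (V : L -> Om -> R) (rho : R) (T : L -> L -> complex R).
Hypothesis mV : forall x, measurable_fun setT (V x).
Hypothesis cond : conditional_density_bounded P V rho.
Hypothesis hermT : hermitian_kernel T.
Variables (n : nat) (alpha : R) (B : 'I_n -> {set L}).
Hypotheses (n0 : (0 < n)%N) (alpha0 : 0 < alpha) (rho0 : 0 <= rho).

(** A bound [ell] on the upper Minkowski content: it controls covers by intervals of one common
    length [h]. Finite unions of intervals have it, and [regular_bound] passes to the limit. *)
Definition fine_cover (J : set R) (ell : R) := forall e, 0 < e ->
  exists2 h0, 0 < h0 & forall h, 0 < h <= h0 -> exists Z : seq R,
    (forall x, J x -> exists2 z, z \in Z & z <= x <= z + h) /\
    h * (size Z)%:R <= ell + e.

(** The constants [b] and [K] quantify boundedness and simplicity, so that one grid and one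
    threshold serve all these potentials. *)
Definition regular_pot (b K : R) (J : 'I_n -> set R) (v : L -> R) :=
  (forall x, - b <= v x < b) /\ exists E psi,
    (forall j, [/\ J j (E j), normalized_eigenfunction T v (E j) (psi j) &
        resolvent_bound T v (E j) (psi j) K]) /\
    distinct_profiles alpha psi B.

(** Markov's inequality on the grid: on each bad cell the profile sum is at least [alpha ^+ n]. For
    each tuple of sites, determinants below [eps] contribute at most [eps] in total;
    [sum_profile_bound] bounds the others. *)
Lemma core_bound (b K : R) (J : 'I_n -> set R) (ell : 'I_n -> R) :
  0 < b -> 0 < K -> (forall j, 0 <= ell j) -> (forall j, fine_cover (J j) (ell j)) ->
  forall e, 0 < e -> exists A : set Om, [/\ measurable A,
    [set w | regular_pot b K J (fun x => V x w)] `<=` A &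
    fine (P A) * alpha ^+ n <=
      n`!%:R * rho ^+ n * \prod_j (ell j * #|B j|%:R) + e].
Proof.
move=> b0 K0 ell0 HJ e e0.
pose NL : R := #|{: {ffun 'I_n -> L}}|%:R.
pose cB : R := \prod_j #|B j|%:R.
pose F : R := n`!%:R.
(* The variable will be [eps], at once the cutoff for determinants, the precision in
   [sum_profile_bound] and the slack of the covers. *)
pose p : {poly R} := NL%:P * 'X + (cB * rho ^+ n * F)%:P * ((1 + 'X) * (1 + 4%:P * 'X) ^+ n) *
    \prod_j ((ell j)%:P + 'X).
have pE x : p.[x] = NL * x + cB * rho ^+ n * F * ((1 + x) * (1 + 4 * x) ^+ n) *
    \prod_j (ell j + x).
  rewrite /p !hornerE horner_prod.
  by congr (_ + _ * _); apply: eq_bigr => j _; rewrite !hornerE.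
have p0 : p.[0] = F * rho ^+ n * \prod_j (ell j * #|B j|%:R).
  rewrite pE big_split /= -/cB; under eq_bigr do rewrite addr0.
  by rewrite !mulr0 !addr0 expr1n; ring.
have [eps eps0 Heps] := poly_le_near0 p e0.
have {Heps} : p.[eps] <= p.[0] + e by apply: Heps; rewrite lexx ltW.
rewrite p0 pE => Heps.
have [h1 h10 H1] := sum_profile_bound mV cond hermT n0 K0 eps0 eps0.
have /choice[hJ HhJ] : forall j, exists h0 : R, 0 < h0 /\ forall h, 0 < h <= h0 ->
    exists Z : seq R, (forall x, J j x -> exists2 z, z \in Z & z <= x <= z + h) /\
    h * (size Z)%:R <= ell j + eps.
  by move=> j; have [h0 h00 HZ] := HJ j eps eps0; exists h0.
pose h := \big[Num.min/h1]_j hJ j.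
have h0 : 0 < h.
  by rewrite /h; elim/big_ind: _ => // [x y x0 y0|j _]; rewrite ?lt_min ?x0 //; case: (HhJ j).
have hh1 : h <= h1 by apply: bigmin_le_id.
have /choice[Z HZ] : forall j, exists Z : seq R,
    (forall x, J j x -> exists2 z, z \in Z & z <= x <= z + h) /\
    h * (size Z)%:R <= ell j + eps.
  by move=> j; have [_] := HhJ j; apply; rewrite h0 /=; apply: bigmin_le.
have N4 : 0 < n%:R + 4 :> R by rewrite ltr_wpDl.
pose ds := Num.min h (eps * h / (n%:R + 4)).
have ds0 : 0 < ds by rewrite lt_min h0 divr_gt0 ?mulr_gt0.
pose M := Num.truncn (2 * b / ds).
pose delta := 2 * b / M.+1%:R.
have M0 : 0 < M.+1%:R :> R by rewrite ltr0n.
have b20 : 0 < 2 * b by rewrite mulr_gt0.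
have d0 : 0 < delta by rewrite divr_gt0.
have dds : delta <= ds.
  rewrite ler_pdivrMr // [ds * _]mulrC -ler_pdivrMr //; apply: ltW.
  by rewrite -truncn_lt_nat // divr_ge0 // ltW.
move: (dds); rewrite le_min ler_pdivlMr // [delta * _]mulrC => /andP[dh de].
have boxed v : regular_pot b K J v -> forall x, - b <= v x < b by case.
have [A [mA SA PA]] := grid_cover P mV M b0 boxed.
exists A; split => //.
move: PA; rewrite -/delta.
pose bad (q : {ffun L -> 'I_M.+1}) :=
  `[< exists2 v, regular_pot b K J v & forall x, slot (- b) delta (q x) (v x) >].
pose ms q := mass P V (- b) delta [set: L]%SET (q : {ffun L -> 'I_M.+1}).
rewrite -/(\sum_(q | bad q) ms q) => PA.
(* One potential with its energies and eigenfunctions is chosen in each bad cell; zero functions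
   fill the other cells. *)
have /choice[D HD] : forall q, exists D : (L -> R) * ('I_n -> R) * ('I_n -> L -> complex R),
   bad q -> [/\ forall x, slot (- b) delta (q x) (D.1.1 x),
     forall j, [/\ J j (D.1.2 j), normalized_eigenfunction T D.1.1 (D.1.2 j) (D.2 j) &
        resolvent_bound T D.1.1 (D.1.2 j) (D.2 j) K] & distinct_profiles alpha D.2 B].
  move=> q; have [/asboolP[v [_ [E [psi [H2 H3]]]] H1']|nb] := boolP (bad q).
    by exists (v, E, psi).
  by exists ((fun=> 0), (fun=> 0), (fun _ _ => 0)).
pose Dt q xs := `|profile_det (D q).2 (xs : {ffun 'I_n -> L})|.
pose X : R := rho ^+ n * ((\prod_j (size (Z j))%:R) *
     (F * ((1 + eps) * ((1 + 4 * eps) * h) ^+ n))).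
have HX (xs : {ffun 'I_n -> L}) : \sum_(q | bad q && (eps <= Dt q xs)) ms q * Dt q xs <= X.
  have hh : 0 < h <= h1 by rewrite h0.
  apply: (H1 h delta hh d0 dh de xs (- b) M.+1 Z bad (fun q => (D q).1.1)
    (fun q => (D q).1.2) (fun q => (D q).2)).
  - by move=> q j /HD[_ /(_ j) [] ].
  - by move=> q j /HD[_ /(_ j) [] ].
  - by move=> q x /HD[].
  - by move=> q j /HD[_ /(_ j) [Jj _ _] _]; have [HZj _] := HZ j; apply: HZj.
have ms0 q : 0 <= ms q by apply: mass_ge0.
have ms1 : \sum_q ms q <= 1.
  have := @sum_mass_le1 _ _ _ _ P V mV (- b) M.+1 delta d0 [set: L]%SET [set: {ffun L -> 'I_M.+1}]%SET.
  rewrite (eq_bigl xpredT) => [H|q]; last by rewrite inE.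
  apply: H => u u' _ _ uu'; apply/exists_inP; rewrite -[X in is_true X]negbK negb_exists_in.
  apply: contra uu' => /forall_inP H; apply/eqP/ffunP => x; apply/eqP.
  by rewrite -[_ == _]negbK; apply: H; rewrite inE.
pose fam (xs : {ffun 'I_n -> L}) := [forall k, xs k \in B k].
have cardfam : (#|fam|)%:R = cB :> R.
  have -> : #|fam| = #|family (fun k => mem (B k))|.
    by apply: eq_card => xs; apply/idP/familyP => [/forallP|H]; [|apply/forallP].
  by rewrite card_familyE natr_prod.
apply: (@le_trans _ _ (\sum_(xs | fam xs) (eps + X))); last first.
  rewrite sumr_const -[_ *+ _]mulr_natl cardfam; apply: le_trans Heps; rewrite mulrDr.
  apply: lerD.
    by rewrite ler_wpM2r ?(ltW eps0) // -cardfam ler_nat max_card.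
  rewrite /X exprMn.
  have -> : cB * (rho ^+ n * (\prod_j (size (Z j))%:R *
      (F * ((1 + eps) * ((1 + 4 * eps) ^+ n * h ^+ n))))) =
    cB * rho ^+ n * F * ((1 + eps) * (1 + 4 * eps) ^+ n) *
      (h ^+ n * \prod_j (size (Z j))%:R) by ring.
  have hn : h ^+ n = \prod_(j < n) h by rewrite prodr_const card_ord.
  rewrite hn -big_split /=; apply: ler_wpM2l.
    by rewrite !mulr_ge0 ?exprn_ge0 ?addr_ge0 ?mulr_ge0 ?(ltW eps0) // /cB prodr_ge0.
  apply: ler_prod => j _; rewrite mulr_ge0 ?(ltW h0) //=.
  by have [_] := HZ j.
apply: (@le_trans _ _ ((\sum_(q | bad q) ms q) * alpha ^+ n)).
  by rewrite ler_wpM2r // exprn_ge0 // ltW.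
rewrite mulr_suml.
apply: (@le_trans _ _ (\sum_(q | bad q) \sum_(xs | fam xs) ms q * Dt q xs)).
  apply: ler_sum => q bq; rewrite -mulr_sumr ler_wpM2l //.
  by have [_ _] := HD q bq.
rewrite exchange_big /=; apply: ler_sum => xs _.
rewrite (bigID (fun q => eps <= Dt q xs)) /= addrC; apply: lerD; last exact: HX.
apply: (@le_trans _ _ (\sum_q ms q * eps)); last first.
  by rewrite -mulr_suml -[leRHS]mul1r ler_wpM2r // ltW.
rewrite [leRHS](bigID (fun q => bad q && ~~ (eps <= Dt q xs))) /=.
rewrite -[leLHS]addr0; apply: lerD; last first.
  by apply: sumr_ge0 => q _; rewrite mulr_ge0 // ltW.
by apply: ler_sum => q /andP[_]; rewrite -ltNge => /ltW ?; rewrite ler_wpM2l.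
Qed.
End Core.

(** * Degenerate energies *)

Section Resolvent.
Local Open Scope complex_scope.
Variables (R : realType) (L : finType).
Local Notation C := (complex R).
Import ComplexField.Normc.

Lemma kernel_inverse_bound (A : L -> L -> C) :
  (forall phi : L -> C, (forall x, \sum_y A x y * phi y = 0) -> forall x, phi x = 0) ->
  exists K : R, forall (phi : L -> C) s,
    (forall x, normc (\sum_y A x y * phi y) <= s) -> forall x, normc (phi x) <= K * s.
Proof.
move=> inj; pose N := #|{: L}|.
pose M : 'M[C]_N := \matrix_(i, j) A (enum_val i) (enum_val j).
have sumE (F : L -> C) : \sum_y F y = \sum_(j < N) F (enum_val j).
  by rewrite (reindex (@enum_val _ {: L})) //=; apply/onW_bij/enum_val_bij.
have uM : M \in unitmx.
  rewrite unitmxE unitfE -det_tr; apply/det0P => -[v v0 vM].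
  move/eqP: v0; apply; apply/matrixP => i j; rewrite ord1 mxE.
  rewrite -[j]enum_valK; apply: (inj (fun x => v 0 (enum_rank x))) => x.
  have /matrixP/(_ 0 (enum_rank x)) := vM; rewrite !mxE => E0; rewrite -[RHS]E0.
  rewrite sumE.
  by apply: eq_bigr => k _; rewrite !mxE enum_rankK enum_valK mulrC.
exists (\sum_i \sum_j normc (invmx M i j)) => phi s Hs x.
pose u : 'cV[C]_N := \col_j phi (enum_val j).
have -> : phi x = (invmx M *m (M *m u)) (enum_rank x) 0.
  by rewrite mulKmx // mxE enum_rankK.
have s0 : 0 <= s by apply: le_trans (Hs x); apply: normc_ge0.
rewrite mxE; apply: le_trans (normc_sum _ _ _) _.
rewrite mulr_suml [leRHS](bigD1 (enum_rank x)) //= -[leLHS]addr0; apply: lerD; last first.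
  by apply: sumr_ge0 => i _; rewrite mulr_ge0 // sumr_ge0 // => j _; apply: normc_ge0.
rewrite mulr_suml; apply: ler_sum => j _; rewrite normcM ler_wpM2l ?normc_ge0 //.
apply: le_trans (Hs (enum_val j)); rewrite le_eqVlt; apply/orP; left; apply/eqP; congr normc.
by rewrite mxE (sumE (fun y => A (enum_val j) y * phi y)); apply: eq_bigr => k _; rewrite !mxE.
Qed.

Variable T : L -> L -> C.
Hypothesis hermT : hermitian_kernel T.

(** The kernel [A] of H - E plus the projection on [psi] is injective: pairing [A phi = 0] with
    [psi] gives [cip psi phi = 0], so [phi] solves the eigenvalue equation, is orthogonal to [psi],
    and vanishes by simplicity. *)
Lemma resolvent_bound_exists v E psi : normalized_eigenfunction T v E psi ->
  (forall phi, (forall x, applyH T v phi x = E%:C * phi x) -> cip psi phi = 0 ->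
     forall x, phi x = 0) ->
  exists K, resolvent_bound T v E psi K.
Proof.
move=> [n1 H] simple.
pose A x y : C := T x y + (if x == y then (v x)%:C - E%:C else 0) + psi x * (psi y)^*%C.
have AE phi x : \sum_y A x y * phi y =
    applyH T v phi x - E%:C * phi x + cip psi phi * psi x.
  rewrite /A /applyH /cip; under eq_bigr do rewrite !mulrDl.
  rewrite !big_split /= mulr_suml; congr (_ + _); last by apply: eq_bigr => y _; ring.
  rewrite -addrA; congr (_ + _); rewrite (bigD1 x) //= eqxx big1 ?addr0; first by ring.
  by move=> y yx; rewrite eq_sym (negbTE yx) mul0r.
have [|K HK] := @kernel_inverse_bound A.
  move=> phi H0.
  have H1 x : applyH T v phi x - E%:C * phi x + cip psi phi * psi x = 0 by rewrite -AE.
  have c0 : cip psi phi = 0.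
    have : cip psi (applyH T v phi) = E%:C * cip psi phi.
      rewrite (hermitian_cip hermT) /cip mulr_sumr; apply: eq_bigr => x _.
      by rewrite H conjcM conjc_real; ring.
    have -> : applyH T v phi = (fun x => E%:C * phi x + (- cip psi phi) * psi x).
      apply: boolp.funext => x; have := H1 x.
      move=> /eqP; rewrite addr_eq0 subr_eq => /eqP ->; ring.
    rewrite cipDr cip_self n1 => /eqP; rewrite -subr_eq0 addrAC subrr add0r mulNr mulr1 oppr_eq0.
    by move/eqP.
  by apply: (simple phi _ c0) => x; have /eqP := H1 x; rewrite c0 mul0r addr0 subr_eq0 => /eqP.
by exists K => phi s Hs; apply: HK => x; rewrite AE.
Qed.

Lemma resolvent_bound_le v E psi (K K' : R) : K <= K' ->
  resolvent_bound T v E psi K -> resolvent_bound T v E psi K'.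
Proof.
move=> KK HK phi s Hs x; apply: le_trans (HK phi s Hs x) _; apply: ler_wpM2r KK.
by apply: le_trans (Hs x); apply: normc_ge0.
Qed.

(** A multiple eigenvalue seen at two sites: the values of [psi] and [chi] at [x] and [y] form a
    triangular matrix with nonzero diagonal, which lets one energy determine two potentials. *)
Definition degenerate_at (x y : L) (v : L -> R) (E : R) (psi chi : L -> C) :=
  [/\ normalized_eigenfunction T v E psi, normalized_eigenfunction T v E chi,
      chi x = 0, psi x != 0 & chi y != 0].

Lemma not_simple_degenerate v E psi : normalized_eigenfunction T v E psi ->
  ~ (exists K, resolvent_bound T v E psi K) ->
  exists x y chi, degenerate_at x y v E psi chi.
Proof.
move=> eig noK; have [n1 H] := eig.
have [phi [Hphi [orth [z phiz]]]] : exists phi,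
   (forall x, applyH T v phi x = E%:C * phi x) /\ cip psi phi = 0 /\ exists z, phi z != 0.
  apply: contra_notP noK => nophi; apply: resolvent_bound_exists eig _ => phi Hphi orth z.
  by apply/eqP; apply: contra_notT nophi => phiz; exists phi; split=> //; split=> //; exists z.
have [x psix] : exists x, psi x != 0.
  apply: contrapT => nex; have := oner_neq0 R; rewrite -n1 big1 ?eqxx // => x _.
  have -> : psi x = 0 by apply: contrapT => px; apply: nex; exists x; apply/eqP.
  by rewrite sqmodE normc0 expr0n.
(* The combination that vanishes at [x]. It is not zero: otherwise pairing with [psi] would give
   [phi x = 0], and then [phi] would vanish. *)
pose f y := phi x * psi y + (- psi x) * phi y.
have Hf y : applyH T v f y = E%:C * f y.
  by rewrite applyH_lin H Hphi /f; ring.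
have [y fy] : exists y, f y != 0.
  apply: contrapT => nex.
  have f0 y : f y = 0 by apply: contrapT => fy; apply: nex; exists y; apply/eqP.
  have : cip psi f = 0 by rewrite /cip big1 // => w _; rewrite f0 mulr0.
  rewrite cipDr orth cip_self n1 mulr0 addr0 mulr1 => phix0.
  have := f0 z; rewrite /f phix0 mul0r add0r mulNr => /eqP.
  by rewrite oppr_eq0 mulf_eq0 (negbTE psix) (negbTE phiz).
pose S := \sum_w sqmod (f w).
have S0 : 0 < S.
  apply: lt_le_trans (_ : sqmod (f y) <= _).
    by rewrite sqmodE exprn_gt0 // lt_neqAle normc_ge0 eq_sym normc_eq0 fy.
  by rewrite /S (bigD1 y) //= lerDl sumr_ge0 // => w _; apply: sqmod_ge0.
pose c := (Num.sqrt S)^-1.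
have c0 : 0 < c by rewrite invr_gt0 sqrtr_gt0.
exists x, y, (fun w => c%:C * f w + 0 * f w); split => //.
- split.
    have E1 w : sqmod (c%:C * f w + 0 * f w) = c ^+ 2 * sqmod (f w).
      by rewrite mul0r addr0 !sqmodE normcM exprMn normc_real real_normK ?num_real.
    under eq_bigr do rewrite E1.
    by rewrite -mulr_sumr -/S /c exprVn sqr_sqrtr ?(ltW S0) // mulVf ?gt_eqF.
  by move=> w; rewrite applyH_lin Hf; ring.
- by rewrite /f; ring.
- by rewrite mul0r addr0 mulf_neq0 // -normc_eq0 normc_real normr_eq0 gt_eqF.
Qed.

End Resolvent.

(** * Probability of potentials with a degenerate energy *)

Section Degenerate.
Local Open Scope complex_scope.
Variables (R : realType) (L : finType) (d : measure_display) (Om : measurableType d).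
Variables (P : probability Om R) (V : L -> Om -> R) (rho : R) (T : L -> L -> complex R).
Hypothesis mV : forall x, measurable_fun setT (V x).
Hypothesis cond : conditional_density_bounded P V rho.
Hypothesis hermT : hermitian_kernel T.
Import ComplexField.Normc.

Definition degenerate_pot (b eta : R) (x y : L) (v : L -> R) :=
  (forall x, - b <= v x < b) /\ exists E psi chi, [/\ - b <= E <= b,
    degenerate_at T x y v E psi chi, eta <= normc (psi x) & eta <= normc (chi y)].

(** The Green identity for [chi] and [chi'], which vanish at [x], controls the change at [y]; the
    one for [psi] and [psi'] then controls the change at [x]. *)
Lemma degenerate_close (x y : L) (v v' : L -> R) E E' psi chi psi' chi' (h delta eta : R) :
  0 < eta -> 0 <= delta -> delta <= h ->
  degenerate_at T x y v E psi chi -> degenerate_at T x y v' E' psi' chi' ->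
  eta <= normc (psi x) -> eta <= normc (chi y) ->
  eta <= normc (psi' x) -> eta <= normc (chi' y) ->
  `|E - E'| <= h -> (forall z, z != x -> z != y -> `|v z - v' z| <= delta) ->
  `|v x - v' x| <= (2 + 2 / eta ^+ 2) / eta ^+ 2 * h /\
  `|v y - v' y| <= (2 + 2 / eta ^+ 2) / eta ^+ 2 * h.
Proof.
move=> eta0 d0 dh [ep ec cx px cy] [ep' ec' cx' px' cy'] h1 h2 h1' h2' hE Hv.
have xy : x != y by apply: contraNneq cy => <-; rewrite cx.
pose xs (i : 'I_2) := if i == 0 then x else y.
have inj : injective xs.
  move=> i j; rewrite /xs; case: (unliftP 0 i) => [i' ->|->]; case: (unliftP 0 j) => [j' ->|->] //=.
  - by rewrite !ord1.
  - by move=> E0; rewrite E0 eqxx in xy.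
  - by move=> E0; rewrite E0 eqxx in xy.
have off z : (forall k, z != xs k) -> `|v z - v' z| <= delta.
  by move=> hz; apply: Hv; [apply: (hz 0)|apply: (hz 1)].
have e20 : 0 < eta ^+ 2 by rewrite exprn_gt0.
have key f g : normalized_eigenfunction T v E f -> normalized_eigenfunction T v' E' g ->
   normc ((v x - v' x)%:C * ((g x)^*%C * f x) + (v y - v' y)%:C * ((g y)^*%C * f y)) <= 2 * h.
  move=> ef eg; have := green_local hermT inj ef eg d0 off.
  rewrite big_ord_recl big_ord1 /xs /=.
  set c := _ * cip g f; set S := _ * _ + _ * _ => HS.
  have -> : S = (S - c) + c by rewrite subrK.
  apply: le_trans (normcD _ _) _; have -> : 2 * h = h + h by ring.
  apply: lerD; first exact: le_trans dh.
  rewrite /c normcM normc_real -[leRHS]mulr1; apply: ler_pM; rewrite ?normc_ge0 //.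
  case: ef => nf _; case: eg => ng _.
  by apply: le_trans (normc_prod_le ng nf); apply: normc_sum.
have big (a b : complex R) : eta <= normc a -> eta <= normc b -> eta ^+ 2 <= normc (a^*%C * b).
  by move=> ha hb; rewrite normcM normc_conj expr2; apply: ler_pM => //; apply: ltW.
have hy : `|v y - v' y| <= 2 * h / eta ^+ 2.
  have := key _ _ ec ec'; rewrite cx !mulr0 add0r normcM normc_real => H.
  rewrite ler_pdivlMr //; apply: le_trans H; apply: ler_wpM2l => //; exact: big.
have h0 : 0 <= h by apply: le_trans dh.
have hx : `|v x - v' x| <= (2 + 2 / eta ^+ 2) / eta ^+ 2 * h.
  have := key _ _ ep ep'; set a := _ * (_ * psi x); set c := _ * (_ * psi y) => H.
  rewrite mulrAC ler_pdivlMr //; apply: le_trans (_ : normc a <= _).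
    by rewrite /a normcM normc_real ler_wpM2l //; apply: big.
  have -> : a = (a + c) - c by rewrite addrK.
  apply: le_trans (normcD _ _) _; rewrite normcN mulrDl; apply: lerD => //.
  have -> : 2 / eta ^+ 2 * h = 2 * h / eta ^+ 2 by rewrite mulrAC.
  apply: le_trans hy; rewrite /c normcM normc_real -[leRHS]mulr1; apply: ler_wpM2l => //.
  rewrite normcM normc_conj -[leRHS]mul1r; case: ep => np _; case: ep' => np' _.
  by apply: ler_pM; rewrite ?normc_ge0 ?normc_le1.
split=> //; apply: le_trans hy _.
have -> : 2 * h / eta ^+ 2 = 2 / eta ^+ 2 * h by rewrite mulrAC.
apply: ler_wpM2r => //; apply: ler_wpM2r; first by rewrite invr_ge0 ltW.
by rewrite lerDl divr_ge0 // ltW.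
Qed.

(** One energy controls two potentials: about [2 * b / h] energy intervals of length [h] each
    contribute an area of order [h ^ 2], in total a quantity of order [h]. *)
Lemma degenerate_bound (b eta : R) (x y : L) : 0 < b -> 0 < eta ->
  forall e, 0 < e -> outer_le P [set w | degenerate_pot b eta x y (fun z => V z w)] e%:E.
Proof.
move=> b0 eta0 e e0.
have [<-|xy] := eqVneq x y.
  exists set0; split=> //; split; last by rewrite measure0 lee_fin ltW.
  by move=> w [_ [E [psi [chi [_ [_ _ c0 _ /eqP]]]]]].
pose C := (2 + 2 / eta ^+ 2) / eta ^+ 2.
have C0 : 0 <= C by rewrite divr_ge0 ?addr_ge0 ?divr_ge0 ?exprn_ge0 // ltW.
pose p : {poly R} := (rho ^+ 2 * (2 * C + 2) ^+ 2)%:P * ((2 * b)%:P + 'X) * 'X.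
have pE t : p.[t] = rho ^+ 2 * (2 * C + 2) ^+ 2 * (2 * b + t) * t by rewrite /p !hornerE.
have [h h0 Hh] := poly_le_near0 p e0.
have {Hh} : p.[h] <= p.[0] + e by apply: Hh; rewrite lexx ltW.
rewrite !pE mulr0 add0r => Hh.
(* [M.+1] serves both as the number of cells per axis and as the number of energy intervals of
   length [h]. *)
pose M := Num.truncn (2 * b / h).
pose delta := 2 * b / M.+1%:R.
have M0 : 0 < M.+1%:R :> R by rewrite ltr0n.
have b20 : 0 < 2 * b by rewrite mulr_gt0.
have d0 : 0 < delta by rewrite divr_gt0.
have dh : delta <= h.
  rewrite /delta ler_pdivrMr // [h * _]mulrC -ler_pdivrMr //; apply: ltW.
  by rewrite -truncn_lt_nat // divr_ge0 // ltW.
have M1 : M.+1%:R * h <= 2 * b + h.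
  rewrite -natr1 mulrDl mul1r lerD2r -ler_pdivlMr //.
  by rewrite truncn_le divr_ge0 // ltW.
have boxed v : degenerate_pot b eta x y v -> forall x, - b <= v x < b by case.
have [A [mA SA PA]] := grid_cover P mV M b0 boxed.
exists A; split => //; split=> //.
rewrite -[P A]fineK ?fin_num_measure // lee_fin; apply: le_trans PA _; rewrite -/delta.
pose bad (q : {ffun L -> 'I_M.+1}) :=
  `[< exists2 v, degenerate_pot b eta x y v & forall x, slot (- b) delta (q x) (v x) >].
pose ms q := mass P V (- b) delta [set: L]%SET (q : {ffun L -> 'I_M.+1}).
rewrite -/(\sum_(q | bad q) ms q).
have /choice[D HD] : forall q, exists D : (L -> R) * R * (L -> complex R) * (L -> complex R),
   bad q -> [/\ forall x, slot (- b) delta (q x) (D.1.1.1 x), - b <= D.1.1.2 <= b,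
     degenerate_at T x y D.1.1.1 D.1.1.2 D.1.2 D.2, eta <= normc (D.1.2 x) &
     eta <= normc (D.2 y)].
  move=> q; have [/asboolP[v [_ [E [psi [chi [H1 H2 H3 H4]]]]] H5]|nb] := boolP (bad q).
    by exists (v, E, psi, chi).
  by exists ((fun=> 0), 0, (fun=> 0), (fun=> 0)).
pose xs (i : 'I_2) := if i == 0 then x else y.
have inj : injective xs.
  move=> i j; rewrite /xs; case: (unliftP 0 i) => [i' ->|->]; case: (unliftP 0 j) => [j' ->|->] //=.
  - by rewrite !ord1.
  - by move=> E0; rewrite E0 eqxx in xy.
  - by move=> E0; rewrite E0 eqxx in xy.
pose g (q : {ffun L -> 'I_M.+1}) : R := if bad q then 1 else 0.
have -> : \sum_(q | bad q) ms q = \sum_q ms q * g q.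
  by rewrite big_mkcond; apply: eq_bigr => q _; rewrite /g; case: ifP; rewrite ?mulr0 ?mulr1.
apply: (@le_trans _ _ (rho ^+ 2 * (M.+1%:R * ((2 * C + 2) * h) ^+ 2))); last first.
  apply: le_trans Hh; rewrite exprMn [h ^+ 2]expr2.
  have -> : rho ^+ 2 * (M.+1%:R * ((2 * C + 2) ^+ 2 * (h * h))) =
     rho ^+ 2 * (2 * C + 2) ^+ 2 * (M.+1%:R * h) * h by ring.
  apply: ler_wpM2r; first exact: ltW.
  by apply: ler_wpM2l => //; rewrite mulr_ge0 ?sqr_ge0.
apply: (sum_mass_le mV cond (- b) d0 inj) => //.
- by rewrite mulr_ge0 ?ler0n // sqr_ge0.
- by move=> q; rewrite /g; case: ifP.
move=> u; pose agree (q : {ffun L -> 'I_M.+1}) := [forall y, (y \notin xs @: 'I_2) ==> (q y == u y)].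
pose zone (q : {ffun L -> 'I_M.+1}) : 'I_M.+1 := inord (Num.truncn (((D q).1.1.2 + b) / h)).
apply: (@le_trans _ _ (\sum_(q | agree q && bad q) delta ^+ 2)).
  rewrite [X in _ <= X]big_mkcondr; apply: ler_sum => q _.
  by rewrite /g; case: ifP; rewrite ?mulr0 ?mulr1.
rewrite (partition_big zone xpredT) //=.
apply: (@le_trans _ _ (\sum_(k < M.+1) ((2 * C + 2) * h) ^+ 2)); last first.
  by rewrite sumr_const card_ord -[_ *+ _]mulr_natl.
apply: ler_sum => k _.
pose B := [set q | (agree q && bad q) && (zone q == k)]%SET.
have -> : \sum_(q | (agree q && bad q) && (zone q == k)) delta ^+ 2 = \sum_(q in B) delta ^+ 2.
  by apply: eq_bigl => q; rewrite inE.
have Bb q : q \in B -> bad q by rewrite inE => /andP [/andP [] ].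
have Bag q z : q \in B -> z != x -> z != y -> q z = u z.
  rewrite inE => /andP [/andP [/forallP ag _] _] zx zy; apply/eqP.
  move: (ag z) => /implyP; apply; apply/imsetP => -[i _]; rewrite /xs; case: ifP => _ /eqP.
    by rewrite (negbTE zx).
  by rewrite (negbTE zy).
have zoneE q : q \in B -> k%:R * h <= (D q).1.1.2 + b <= k%:R * h + h.
  move=> qB; have [_ /andP[E1 E2] _ _ _] := HD q (Bb q qB).
  have p0 : 0 <= ((D q).1.1.2 + b) / h by rewrite divr_ge0 ?(ltW h0) //; lra.
  have kE : k = Num.truncn (((D q).1.1.2 + b) / h) :> nat.
    move: qB; rewrite inE => /andP [_ /eqP <-]; rewrite /zone inordK // ltnS.
    by apply: le_truncn; rewrite ler_wpM2r ?invr_ge0 ?(ltW h0) //; lra.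
  have /andP[t1 t2] := truncn_itv p0; rewrite -kE in t1 t2.
  rewrite ler_pdivlMr // in t1; rewrite t1 /=; apply: ltW.
  by rewrite ltr_pdivrMr // -natr1 mulrDl mul1r in t2.
have closeB q q' : q \in B -> q' \in B ->
   `|(D q).1.1.1 x - (D q').1.1.1 x| <= C * h /\ `|(D q).1.1.1 y - (D q').1.1.1 y| <= C * h.
  move=> qB qB'; have [s1 _ dg1 p1 c1] := HD q (Bb q qB); have [s2 _ dg2 p2 c2] := HD q' (Bb q' qB').
  apply: (degenerate_close eta0 (ltW d0) dh dg1 dg2) => //.
    have /andP[? ?] := zoneE q qB; have /andP[? ?] := zoneE q' qB'.
    by rewrite ler_norml; apply/andP; split; lra.
  move=> z zx zy; move: (s1 z) (s2 z); rewrite (Bag q z) // (Bag q' z) // /slot /= !in_itv /=.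
  rewrite -natr1 mulrDr mulr1.
  by move=> /andP[? ?] /andP[? ?]; rewrite ler_norml; apply/andP; split; lra.
rewrite sumr_const -[_ *+ _]mulr_natl.
have [->|[q0 q0B]] := set_0Vmem B; first by rewrite cards0 mul0r sqr_ge0.
pose m (q : {ffun L -> 'I_M.+1}) : 'cV[int]_2 := \col_k (q (xs k) : nat)%:Z.
pose W := 2 * C * h / delta + 2.
have W0 : 0 <= W.
  by apply: addr_ge0 => //; apply: divr_ge0 (ltW d0); apply: mulr_ge0 (ltW h0); apply: mulr_ge0.
pose v0 := (D q0).1.1.1.
(* Packing with the identity matrix: in units of [delta] the potentials lie in a square of side
   [2 * C * h / delta], enlarged by 1 on each side for the extent of a cell. *)
have := @packing R 2 1%:M [seq m q | q <- enum B]
  (fun i => (v0 (xs i) - C * h + b) / delta - 1) (fun=> W).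
rewrite size_map -cardE det1 normr1 mulr1 prodr_const card_ord oner_neq0.
have -> : ((2 * C + 2) * h) ^+ 2 = (((2 * C + 2) * h) / delta) ^+ 2 * delta ^+ 2.
  by rewrite -exprMn divfK // gt_eqF.
move=> pk; apply: ler_wpM2r; first exact: sqr_ge0.
apply: (@le_trans _ _ (W ^+ 2)); last first.
  apply: lerXn2r; rewrite ?nnegrE ?W0 //.
    apply: divr_ge0 (ltW d0); apply: mulr_ge0 (ltW h0).
    by apply: addr_ge0 => //; apply: mulr_ge0.
  rewrite ler_pdivlMr //.
  have -> : W * delta = 2 * C * h + 2 * delta by rewrite /W mulrDl divfK // gt_eqF.
  have -> : (2 * C + 2) * h = 2 * C * h + 2 * h by ring.
  by rewrite lerD2l; apply: ler_wpM2l.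
apply: pk => //.
- rewrite map_inj_in_uniq ?enum_uniq // => q q'; rewrite !mem_enum => qB qB' /matrixP E'.
  apply/ffunP => z; have [->|zx] := eqVneq z x.
    by apply/val_inj; have := E' 0 0; rewrite !mxE => -[].
  have [->|zy] := eqVneq z y.
    by apply/val_inj; have := E' 1 0; rewrite !mxE => -[].
  by rewrite (Bag q z) // (Bag q' z).
- move=> mq /mapP[q]; rewrite mem_enum => qB -> w hw i; rewrite mul1mx.
  have [s _ _ _ _] := HD q (Bb q qB).
  have close_i : `|(D q).1.1.1 (xs i) - v0 (xs i)| <= C * h.
    by have [? ?] := closeB q q0 qB q0B; rewrite /xs; case: ifP.
  have := s (xs i); have /andP[w1 w2] := hw i; move: w1 w2 close_i.
  rewrite mxE -[_%:~R]/((q (xs i))%:R) /slot /= in_itv /= -natr1.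
  set a := (q (xs i))%:R; set t := (D q).1.1.1 (xs i); rewrite ler_norml.
  move=> w1 w2 /andP[l1 l2] /andP[s1 s2].
  have g1 : a <= (t + b) / delta by rewrite ler_pdivlMr // mulrC; lra.
  have g2 : (t + b) / delta <= a + 1 by apply: ltW; rewrite ltr_pdivrMr // mulrC; lra.
  have f1 : (v0 (xs i) - C * h + b) / delta <= (t + b) / delta.
    by rewrite ler_wpM2r ?invr_ge0 ?(ltW d0) //; lra.
  have f2 : (t + b) / delta <= (v0 (xs i) - C * h + b) / delta + 2 * C * h / delta.
    by rewrite -mulrDl ler_wpM2r ?invr_ge0 ?(ltW d0) //; lra.
  by rewrite /W; apply/andP; split; lra.
Qed.

End Degenerate.

(** * Covering Borel sets by short intervals *)

Section Covers.
Variable R : realType.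

(** Intervals of length [h] cover each of the [M] given ones with an excess length of at most [h],
    and [M * h] is kept below [e]. *)
Lemma fine_cover_seq (J : set R) (M : nat) (a b : nat -> R) (ell : R) :
  (forall i, a i <= b i) ->
  (forall x, J x -> exists2 i, (i < M)%N & a i <= x <= b i) ->
  \sum_(0 <= i < M) (b i - a i) <= ell -> fine_cover J ell.
Proof.
move=> ab HJ Hell e e0.
have M0 : 0 < M.+1%:R :> R by rewrite ltr0n.
exists (e / M.+1%:R); first by rewrite divr_gt0.
move=> h /andP[h0 he].
pose len i := Num.truncn ((b i - a i) / h).
have q0 i : 0 <= (b i - a i) / h by rewrite divr_ge0 ?(ltW h0) // subr_ge0.
exists (flatten [seq [seq a i + h * k%:R | k <- iota 0 (len i).+1] | i <- iota 0 M]); split.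
  move=> x /HJ[i iM /andP[ax xb]].
  have p0 : 0 <= (x - a i) / h by rewrite divr_ge0 ?(ltW h0) // subr_ge0.
  have /andP[t1 t2] := truncn_itv p0; set k := Num.truncn _ in t1 t2.
  rewrite ler_pdivlMr // in t1; rewrite ltr_pdivrMr // -natr1 mulrDl mul1r in t2.
  exists (a i + h * k%:R).
    apply/flattenP; exists [seq a i + h * k%:R | k <- iota 0 (len i).+1].
      by apply/mapP; exists i; rewrite ?mem_iota.
    apply/mapP; exists k => //; rewrite mem_iota /= add0n ltnS; apply: le_truncn.
    by rewrite ler_wpM2r ?invr_ge0 ?(ltW h0) // lerB.
  by rewrite mulrC; apply/andP; split; lra.
rewrite size_flatten /shape -map_comp sumnE big_map natr_sum mulr_sumr.
apply: (@le_trans _ _ (\sum_(i <- iota 0 M) ((b i - a i) + h))).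
  apply: ler_sum => i _ /=; rewrite size_map size_iota -natr1 mulrDr mulr1 lerD2r.
  by rewrite mulrC -ler_pdivlMr // truncn_le.
rewrite big_split /= big_const_seq count_predT iter_addr_0 size_iota.
apply: lerD; first by rewrite -[M in iota 0 M]subn0.
rewrite -[_ *+ M]mulr_natr; rewrite ler_pdivlMr // in he.
by apply: le_trans he; rewrite ler_wpM2l ?(ltW h0) // ler_nat.
Qed.

Lemma interval_cover (I : set R) (ell e : R) :
  (lebesgue_measure I <= ell%:E)%E -> 0 < e ->
  exists a b : nat -> R, [/\ forall i, a i <= b i,
    forall x, I x -> exists i, a i <= x <= b i &
    forall M, \sum_(0 <= i < M) (b i - a i) <= ell + e].
Proof.
move=> HI e0.
have inf_fin : lebesgue_measure I \is a fin_num.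
  by rewrite ge0_fin_numE ?measure_ge0 //; apply: le_lt_trans HI _; rewrite ltry.
have [_ [F [mF IF] <-]] := lb_ereal_inf_adherent e0 inf_fin.
rewrite -/(lebesgue_measure I) => Hlt.
have /choice[ab Hab] : forall i, exists ab : R * R, ab.1 <= ab.2 /\
    F i `<=` `[ab.1, ab.2] /\ wlength idfun (F i) = (ab.2 - ab.1)%:E.
  move=> i; have [[x y] _ /= Fi] := mF i.
  have [xy|yx] := ltP x y.
    exists (x, y) => /=; split; first exact: ltW.
    rewrite -Fi; split; first by apply: subset_itv_oc_cc.
    by rewrite wlength_itv /= lte_fin xy EFinB.
  (* An empty interval is replaced by the point 0, which keeps the endpoints ordered and adds no
     length. *)
  exists (0, 0); split => //=; rewrite -Fi set_itv_ge ?bnd_simp -?leNgt //.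
  by split; [exact: sub0set | rewrite subrr wlength0].
exists (fun i => (ab i).1), (fun i => (ab i).2); split.
- by move=> i; case: (Hab i).
- by move=> x /IF[i _ Fx]; exists i; have [_ [sub _]] := Hab i; have := sub _ Fx; rewrite /= in_itv.
move=> M; rewrite -lee_fin -sumEFin.
apply: (@le_trans _ _ (lebesgue_measure I + e%:E)%E); last by rewrite EFinD leeD2r.
apply: le_trans (ltW Hlt).
under eq_bigr do rewrite -(proj2 (proj2 (Hab _))).
by apply: nneseries_lim_ge => i _ _; apply: wlength_ge0.
Qed.

End Covers.

(** * Conclusion *)

Lemma fin_nat_bound (R : realType) (I : finType) (f : I -> R) :
  exists N : nat, forall i, f i <= N%:R.
Proof.
exists (Num.truncn (\sum_i `|f i|)).+1 => i.
apply: (@le_trans _ _ (\sum_i `|f i|)); last first.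
  by apply: ltW; rewrite -truncn_lt_nat // sumr_ge0.
by rewrite (bigD1 i) //=; apply: le_trans (ler_norm _) _; rewrite lerDl sumr_ge0.
Qed.

Lemma outer_le_fin (R : realType) (d : measure_display) (Om : measurableType d)
    (P : probability Om R) (I : finType) (S : I -> set Om) :
  (forall i, outer_le P (S i) 0) -> outer_le P [set w | exists i, S i w] 0.
Proof.
move=> H.
have Hs (s : seq I) : outer_le P [set w | exists2 i, i \in s & S i w] 0.
  elim: s => [|i s IH].
    exists set0; split=> //; split; last by rewrite measure0.
    by move=> w [].
  apply: outer_leS (outer_leU IH (H i)) => w [k]; rewrite inE => /orP[/eqP->|ks] Sk.
    by right.
  by left; exists k.
by apply: outer_leS (Hs (enum I)) => w [i Si]; exists i => //; rewrite mem_enum.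
Qed.

Section Assembly.
Variables (R : realType) (L : finType) (d : measure_display) (Om : measurableType d).
Variables (P : probability Om R) (V : L -> Om -> R) (rho : R) (T : L -> L -> complex R).
Hypothesis mV : forall x, measurable_fun setT (V x).
Hypothesis cond : conditional_density_bounded P V rho.
Hypothesis hermT : hermitian_kernel T.
Hypothesis rho0 : 0 <= rho.
Import ComplexField.Normc.

(** For each of the finitely many pairs of sites, the degenerate potentials are exhausted by an
    increasing sequence of sets that [degenerate_bound] makes null. *)
Lemma degenerate_null : outer_le P
  [set w | exists x y E psi chi, degenerate_at T x y (fun z => V z w) E psi chi] 0.
Proof.
pose S (p : L * L) (N : nat) :=
  [set w | degenerate_pot T N.+1%:R N.+1%:R^-1 p.1 p.2 (fun z => V z w)].
apply: (@outer_leS _ _ _ _ _ [set w | exists p, (\bigcup_N S p N) w]).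
  move=> w [x [y [E [psi [chi dg]]]]]; exists (x, y).
  have [_ _ _ px cy] := dg.
  have px0 : 0 < normc (psi x) by rewrite lt_neqAle normc_ge0 eq_sym normc_eq0 px.
  have cy0 : 0 < normc (chi y) by rewrite lt_neqAle normc_ge0 eq_sym normc_eq0 cy.
  have [N1 H1] := fin_nat_bound (fun z => `|V z w|).
  have [N2 H2] := fin_nat_bound (fun k : 'I_3 => nth 0 [:: `|E|; (normc (psi x))^-1; (normc (chi y))^-1] k).
  exists (N1 + N2)%N => //; split => /=.
    move=> z; have := H1 z; rewrite ler_norml => /andP[a1 a2].
    have : N1%:R + 0 < (N1 + N2).+1%:R :> R by rewrite addr0 ltr_nat ltnS leq_addr.
    by move=> h; apply/andP; split; lra.
  have N2le : N2%:R <= (N1 + N2).+1%:R :> R by rewrite ler_nat leqW // leq_addl.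
  exists E, psi, chi; split => //.
  - rewrite -ler_norml; exact: le_trans (H2 ord0) N2le.
  - rewrite -[leRHS]invrK lef_pV2 ?posrE ?invr_gt0 ?ltr0n //.
    exact: le_trans (H2 (Ordinal (isT : 1 < 3)%N)) N2le.
  - rewrite -[leRHS]invrK lef_pV2 ?posrE ?invr_gt0 ?ltr0n //.
    exact: le_trans (H2 (Ordinal (isT : 2 < 3)%N)) N2le.
apply: outer_le_fin => p; apply: outer_le_bigcup.
  move=> i j ij w [Hb [E [psi [chi [HE dg h1 h2]]]]].
  have ijR : i.+1%:R <= j.+1%:R :> R by rewrite ler_nat.
  have ijV : j.+1%:R^-1 <= i.+1%:R^-1 :> R by rewrite lef_pV2 // posrE ltr0n.
  split; first by move=> z; have /andP[? ?] := Hb z; apply/andP; split; lra.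
  exists E, psi, chi; split => //.
  - by case/andP: HE => ? ?; apply/andP; split; lra.
  - exact: le_trans h1.
  - exact: le_trans h2.
move=> N; apply: outer_le_lim => e e0; rewrite add0e.
have N1 : 0 < N.+1%:R :> R by rewrite ltr0n.
have N2 : 0 < N.+1%:R^-1 :> R by rewrite invr_gt0.
exact: (degenerate_bound mV cond hermT p.1 p.2 N1 N2 e0).
Qed.

Variables (n : nat) (alpha : R) (B : 'I_n -> {set L}).
Hypotheses (n0 : (0 < n)%N) (alpha0 : 0 < alpha).

Lemma regular_pot_mono b b' K K' (J J' : 'I_n -> set R) v : b <= b' -> K <= K' ->
  (forall j, J j `<=` J' j) ->
  regular_pot T alpha B b K J v -> regular_pot T alpha B b' K' J' v.
Proof.
move=> bb KK JJ [Hb [E [psi [H dp]]]]; split.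
  by move=> z; have /andP[? ?] := Hb z; apply/andP; split; lra.
exists E, psi; split=> // j; have [h1 h2 h3] := H j; split=> //; first exact: JJ.
exact: resolvent_bound_le h3.
Qed.

(** Countable interval covers of the [I j] are truncated to [M] intervals, to which [core_bound]
    applies. As there are only [n] energies, some [M] captures them all, so the truncated events
    increase to a cover. *)
Lemma regular_bound (b K : R) (I : 'I_n -> set R) (ell : 'I_n -> R) :
  0 < b -> 0 < K -> (forall j, 0 <= ell j) ->
  (forall j, (lebesgue_measure (I j) <= (ell j)%:E)%E) ->
  outer_le P [set w | regular_pot T alpha B b K I (fun x => V x w)]
    (n`!%:R / alpha ^+ n * rho ^+ n * \prod_j (ell j * #|B j|%:R))%:E.
Proof.
move=> b0 K0 ell0 HI.
have an0 : 0 < alpha ^+ n by rewrite exprn_gt0.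
pose c0 := n`!%:R / alpha ^+ n * rho ^+ n.
pose p : {poly R} := c0%:P * \prod_j (((ell j)%:P + 'X) * (#|B j|%:R)%:P).
have pE t : p.[t] = c0 * \prod_j ((ell j + t) * #|B j|%:R).
  by rewrite /p !hornerE horner_prod; congr (_ * _); apply: eq_bigr => j _; rewrite !hornerE.
apply: outer_le_lim => e e0.
have [t t0 Ht] := poly_le_near0 p e0.
have {Ht} : p.[t] <= p.[0] + e by apply: Ht; rewrite lexx ltW.
have -> : p.[0] = c0 * \prod_j (ell j * #|B j|%:R).
  by rewrite pE; under eq_bigr do rewrite addr0.
rewrite pE => Ht.
have /choice[ab Hab] : forall j, exists ab : (nat -> R) * (nat -> R),
    [/\ forall i, ab.1 i <= ab.2 i, forall x, I j x -> exists i, ab.1 i <= x <= ab.2 i &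
    forall M, \sum_(0 <= i < M) (ab.2 i - ab.1 i) <= ell j + t].
  by move=> j; have [a [b' H]] := interval_cover (HI j) t0; exists (a, b').
pose J (M : nat) (j : 'I_n) : set R :=
  [set x | exists2 i, (i < M)%N & (ab j).1 i <= x <= (ab j).2 i].
apply: (@outer_leS _ _ _ _ _ (\bigcup_M [set w | regular_pot T alpha B b K (J M) (fun x => V x w)])).
  move=> w [Hb [E [psi [H dp]]]].
  have /choice[ix Hix] : forall j, exists i, (ab j).1 i <= E j <= (ab j).2 i.
    by move=> j; have [_ cov _] := Hab j; apply: cov; case: (H j).
  exists (\max_j ix j).+1 => //; split=> //; exists E, psi; split=> // j.
  have [_ h2 h3] := H j; split=> //; exists (ix j) => //.
  by rewrite ltnS; apply: leq_bigmax.
apply: outer_le_bigcup.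
  move=> M M' MM w; apply: regular_pot_mono => // j x [i iM hx]; exists i => //.
  exact: leq_trans MM.
move=> M; apply: outer_le_lim => e' e'0.
have cov j : fine_cover (J M j) (ell j + t).
  have [h1 _ h3] := Hab j; apply: (@fine_cover_seq _ _ M (ab j).1 (ab j).2) => //.
have ellt0 j : 0 <= ell j + t by rewrite addr_ge0 // ltW.
have [A [mA SA PA]] := core_bound mV cond hermT B n0 alpha0 rho0 b0 K0 ellt0 cov (mulr_gt0 e'0 an0).
exists A; split=> //; split=> //.
rewrite -[P A]fineK ?fin_num_measure // -!EFinD lee_fin.
apply: le_trans (_ : c0 * (\prod_j ((ell j + t) * #|B j|%:R)) + e' <= _).
  rewrite -(ler_pM2r an0) mulrDl; apply: le_trans PA _; rewrite lerD2r /c0.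
  by rewrite le_eqVlt; apply/orP; left; apply/eqP; field; rewrite gt_eqF.
by rewrite lerD2r.
Qed.

(** Either every energy has a resolvent bound and a large [N] dominates all constants, or some
    energy is degenerate. *)
Lemma event_cover (I : 'I_n -> set R) :
  event_distinct T V alpha I B `<=`
  (\bigcup_N [set w | regular_pot T alpha B N.+1%:R N.+1%:R
     (fun j => I j `&` `[- N.+1%:R, N.+1%:R]) (fun x => V x w)]) `|`
  [set w | exists x y E psi chi, degenerate_at T x y (fun z => V z w) E psi chi].
Proof.
move=> w [E [psi [H dp]]].
have [HK|/existsNP[j noK]] := pselect (forall j, exists K,
    resolvent_bound T (fun x => V x w) (E j) (psi j) K); last first.
  right; have [_ eig] := H j; have [x [y [chi dg]]] := not_simple_degenerate hermT eig noK.
  by exists x, y, (E j), (psi j), chi.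
left; have /choice[K {}HK] := HK.
have [N1 H1] := fin_nat_bound (fun z => `|V z w|).
have [N2 H2] := fin_nat_bound (fun j => `|E j|).
have [N3 H3] := fin_nat_bound K.
exists (N1 + N2 + N3)%N => //.
have l1 : N1%:R < (N1 + N2 + N3).+1%:R :> R by rewrite ltr_nat ltnS -addnA leq_addr.
have l2 : N2%:R <= (N1 + N2 + N3).+1%:R :> R.
  by rewrite ler_nat leqW // addnAC leq_addl.
have l3 : N3%:R <= (N1 + N2 + N3).+1%:R :> R by rewrite ler_nat leqW // leq_addl.
split.
  by move=> z; have := H1 z; rewrite ler_norml => /andP[? ?]; apply/andP; split; lra.
exists E, psi; split=> // j; have [Ij eig] := H j; split=> //.
  split=> //; rewrite /= in_itv /= -ler_norml; exact: le_trans (H2 j) l2.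
apply: resolvent_bound_le (HK j); exact: le_trans (H3 j) l3.
Qed.

Lemma event_bound (I : 'I_n -> set R) : (forall j, measurable (I j)) ->
  outer_le P (event_distinct T V alpha I B)
    ((n`!%:R / alpha ^+ n * rho ^+ n)%:E *
       \prod_(j < n) (lebesgue_measure (I j) * (#|B j|%:R)%:E))%E.
Proof.
move=> mI; apply: (outer_leS (@event_cover I)).
apply: outer_leU degenerate_null; apply: outer_le_bigcup.
  move=> N N' NN w; have NR : N.+1%:R <= N'.+1%:R :> R by rewrite ler_nat.
  apply: regular_pot_mono => // j x [Ix /=]; rewrite in_itv /= => /andP[? ?].
  by split=> //; rewrite /= in_itv /=; apply/andP; split; lra.
(* The cut at [N.+1] makes all lengths finite, as the real-valued [regular_bound] demands; the [I j]
   may have infinite measure. *)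
move=> N; set J := fun j : 'I_n => _.
have mJ j : measurable (J j) by apply: measurableI => //; apply: measurable_itv.
have Jfin j : lebesgue_measure (J j) \is a fin_num.
  pose Q : set R := `[- N.+1%:R, N.+1%:R]%classic.
  rewrite ge0_fin_numE ?measure_ge0 //; apply: (@le_lt_trans _ _ (lebesgue_measure Q)).
    have mQ : measurable Q by rewrite /Q; apply: measurable_itv.
    by apply: le_measure; rewrite ?inE //; [apply: mJ | apply: subIsetr].
  by rewrite /Q lebesgue_measure_itv; case: ifP; rewrite ?ltry //= -EFinD ltry.
have ell0 j : 0 <= fine (lebesgue_measure (J j)) by apply: fine_ge0; apply: measure_ge0.
have [|A [mA [SA PA]]] := @regular_bound N.+1%:R N.+1%:R J _ (ltr0Sn _ _) (ltr0Sn _ _) ell0.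
  by move=> j; rewrite fineK.
exists A; split=> //; split=> //; apply: le_trans PA _.
rewrite EFinM; apply: lee_wpmul2l.
  by rewrite lee_fin mulr_ge0 ?exprn_ge0 // divr_ge0 // exprn_ge0 // ltW.
suff : (0 <= (\prod_(j < n) (fine (lebesgue_measure (J j)) * #|B j|%:R))%:E <=
   \prod_(j < n) (lebesgue_measure (I j) * (#|B j|%:R)%:E))%E by case/andP.
elim/big_ind2: _ => [|a1 a2 b1 b2 /andP[? ?] /andP[? ?]|j _].
- by rewrite lee_fin ler01 /=.
- by rewrite EFinM mule_ge0 //= lee_pmul.
rewrite EFinM mule_ge0 ?lee_fin //= fineK //; apply: lee_wpmul2r; first by rewrite lee_fin.
by apply: le_measure; rewrite ?inE //; [apply: mJ | apply: mI | apply: subIsetl].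
Qed.

End Assembly.

Unset Implicit Arguments. Set Strict Implicit. Set Printing Implicit Defensive.

(** The conclusion bounds the outer probability of the event; for a measurable event, monotonicity
    turns it into a bound on its probability. *)
Theorem theorem1 (R : realType) (L : finType) (d : measure_display)
  (Om : measurableType d) (P : probability Om R)
  (T : L -> L -> complex R) (V : L -> Om -> R) (rho : R)
  (n : nat) (alpha : R) (I : 'I_n -> set R) (B : 'I_n -> {set L}) :
  hermitian_kernel T ->
  (forall x, measurable_fun setT (V x)) ->
  conditional_density_bounded P V rho ->
  (0 < n)%N -> 0 < alpha ->
  (forall j, measurable (I j)) ->
  exists A : set Om, measurable A /\ event_distinct T V alpha I B `<=` A /\
    (P A <= ((factorial n)%:R / alpha ^+ n * rho ^+ n)%:E *
             \prod_(j < n) (lebesgue_measure (I j) * (#|B j|%:R)%:E))%E.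
Proof.
move=> hermT mV cond n0 alpha0 mI.
(* A site is required to derive [0 <= rho]. If [L] is empty, the profile sum is empty and cannot
   reach [alpha ^+ n > 0], so the event is empty. *)
have [x _|L0] := pickP (fun x : L => true).
  exact: (event_bound mV cond hermT (rho_ge0 cond x)).
exists set0; split=> //; split; last first.
  rewrite measure0 (bigD1 (Ordinal n0)) //=.
  have -> : B (Ordinal n0) = finset.set0 by apply/setP => x; have := L0 x.
  by rewrite cards0 mule0 mul0e mule0.
move=> w [E [psi [_]]]; rewrite /distinct_profiles big1; last first.
  by move=> xs _; have := L0 (xs (Ordinal n0)).
by rewrite leNgt exprn_gt0.
Qed.
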